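(* With the notation below: (i) Let $D\in\mathrm{Div}(C_p)$ with $\deg(D)\geq0$. Then the limit $\mathrm{Dim}_{\mathbb{R}}(H^0(D))=\lim_{n\to\infty}p^{-n}\dim_{\mathrm{top}}(H^0(D)^{p^n})$ exists and equals $\deg(D)$. (ii) For every $D\in\mathrm{Div}(C_p)$ the limits $\mathrm{Dim}_{\mathbb{R}}(H^0(D))$ and $\mathrm{Dim}_{\mathbb{R}}(H^0(-D))$ exist and satisfy the Riemann–Roch formula $\mathrm{Dim}_{\mathbb{R}}(H^0(D))-\mathrm{Dim}_{\mathbb{R}}(H^0(-D))=\deg(D)$.
   Context: Let $p$ be a prime, $H_p=\mathbb{Z}[1/p]$, $|\cdot|_p$ the $p$-adic absolute value with $|p|_p=1/p$. $C_p$ is the set of subgroups $H=\lambda H_p\subset\mathbb{R}$, $\lambda>0$. $\mathcal K(C_p)$: continuous piecewise affine $f:(0,\infty)\to\mathbb{R}$ with slopes in $H_p$ and $f(p\lambda)=f(\lambda)$, plus the constant $-\infty$. For real-valued $f$ and $H=\lambda H_p$, $\mathrm{Ord}_H(f)=h_+-h_-$ with $h_\pm=\lim_{\epsilon\to0\pm}(f((1+\epsilon)\lambda)-f(\lambda))/\epsilon\in H$; principal divisor $(f)(H)=\mathrm{Ord}_H(f)$. A divisor $D$ assigns $D(H)\in H$ to each $H\in C_p$, zero for all but finitely many $H$; $\mathrm{Div}(C_p)$ is the group of divisors, ordered pointwise; $\deg(D)=\sum_HD(H)$. $H^0(D)=\{f\in\mathcal K(C_p)\text{ real-valued}\mid D+(f)\geq0\}\cup\{-\infty\}$,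 with the topology of uniform convergence given by $d(f,g)=\max_{x\in[1,p]}|f(x)-g(x)|$. For real-valued $f$, $\|f\|_p=\max\{|h|_p/\lambda\}$ over $\lambda>0$ and $h$ the left and right slopes of $f$ at $\lambda$; $H^0(D)^\rho=\{f\in H^0(D)\mid\|f\|_p\leq\rho\}$ (containing $-\infty$). $\dim_{\mathrm{top}}$ is the Lebesgue covering dimension: the least integer $n$ such that every open cover admits a refinement in which every point lies in at most $n+1$ members. *)

(* Defs.v *)
From HB Require Import structures.
From mathcomp Require Import all_boot all_order all_algebra.
From mathcomp Require Import all_classical all_reals all_analysis.
Set Implicit Arguments. Unset Strict Implicit. Unset Printing Implicit Defensive.
Import Order.TTheory GRing.Theory Num.Theory.
Import numFieldNormedType.Exports.
Local Open Scope classical_set_scope.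
Local Open Scope ring_scope.

Section Defs.
Variable R : realType.
Variable p : nat.

Definition inHp (h : R) : Prop :=
  exists (a : int) (k : nat), h = a%:~R / (p%:R ^+ k).

Definition HpSet (l : R) : set R := [set l * h | h in inHp].

Definition Cp : set (set R) := [set H | exists l : R, 0 < l /\ H = HpSet l].

Definition isDivisor (D : set R -> R) : Prop :=
  [/\ forall H, ~ Cp H -> D H = 0,
      forall H, Cp H -> H (D H) &
      finite_set [set H | Cp H /\ D H != 0]].

Definition deg (D : set R -> R) : R := \sum_(H \in [set H | Cp H /\ D H != 0]) D H.

Definition affine_on (f : R -> R) (a b : R) : Prop :=
  exists c s : R, inHp s /\ forall x, a <= x <= b -> f x = c + s * x.

(* real-valued elements of K(C_p); values for x <= 0 normalized to 0 *)
Definition inK (f : R -> R) : Prop :=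
  [/\ forall x, x <= 0 -> f x = 0,
      {in `]0, +oo[, continuous f},
      forall a b, 0 < a -> a < b ->
        exists (m : nat) (t : nat -> R), t 0%N = a /\ t m = b /\
          forall i, (i < m)%N -> t i < t i.+1 /\ affine_on f (t i) (t i.+1) &
      forall x, 0 < x -> f (p%:R * x) = f x].

Definition hplus (f : R -> R) (l : R) : R :=
  lim ((fun e => (f ((1 + e) * l) - f l) / e) @ 0^'+).
Definition hminus (f : R -> R) (l : R) : R :=
  lim ((fun e => (f ((1 + e) * l) - f l) / e) @ 0^'-).
Definition Ord (f : R -> R) (l : R) : R := hplus f l - hminus f l.

Definition rslope (f : R -> R) (l : R) : R :=
  lim ((fun x => (f x - f l) / (x - l)) @ l^'+).
Definition lslope (f : R -> R) (l : R) : R :=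
  lim ((fun x => (f x - f l) / (x - l)) @ l^'-).

Definition padic_abs_is (h r : R) : Prop :=
  (h = 0 /\ r = 0) \/
  exists (v u : int), ~~ ((p%:Z) %| u)%Z /\ h = (p%:R ^ v) * u%:~R /\ r = p%:R ^ (- v).

Definition pnorm_le (f : R -> R) (rho : R) : Prop :=
  forall l, 0 < l -> forall h, (h = lslope f l \/ h = rslope f l) ->
    forall r, padic_abs_is h r -> r / l <= rho.

(* H^0(D)^rho ; None stands for the constant -oo *)
Definition H0rho (D : set R -> R) (rho : R) : set (option (R -> R)) :=
  [set x | x = None \/ exists f, x = Some f /\ inK f /\
     (forall l, 0 < l -> 0 <= D (HpSet l) + Ord f l) /\ pnorm_le f rho].

(* d(x, y) < e, with d(f,g) = max_{[1,p]} |f - g| and -oo at infinite distance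
   from every real-valued function *)
Definition dlt (x y : option (R -> R)) (e : R) : Prop :=
  match x, y with
  | None, None => True
  | Some f, Some g => forall t, 1 <= t <= p%:R -> `|f t - g t| < e
  | _, _ => False
  end.

End Defs.

Section CovDim.
Variables (R : realType) (T : Type) (dl : T -> T -> R -> Prop).

Definition sub_open (X U : set T) : Prop :=
  U `<=` X /\ forall x, U x -> exists e : R, 0 < e /\ forall y, X y -> dl x y e -> U y.

Definition open_cover (X : set T) (C : set (set T)) : Prop :=
  (forall U, C U -> sub_open X U) /\ (forall x, X x -> exists U, C U /\ U x).

Definition cover_order_le (X : set T) (k : nat) : Prop :=
  forall C, open_cover X C -> exists C', open_cover X C' /\
    (forall V, C' V -> exists U, C U /\ V `<=` U) /\
    (forall x, X x -> forall W : nat -> set T,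
       (forall i, (i < k.+1)%N -> C' (W i) /\ W i x) ->
       exists i j, (i < j < k.+1)%N /\ W i = W j).

(* dim_top X = least integer n with cover_order_le X (n+1); +oo if none *)
Definition covdim (X : set T) : \bar R :=
  ereal_inf [set ((k%:R - 1)%:E : \bar R) | k in [set k | cover_order_le X k]].

End CovDim.

Definition DimSeq (R : realType) (p : nat) (D : set R -> R) : nat -> \bar R :=
  fun n => ((p%:R ^- n : R)%:E * covdim (@dlt R p) (H0rho p D (p%:R ^+ n)))%E.

(* Main.v *)
Require Import Defs.
From HB Require Import structures.
From mathcomp Require Import all_boot all_order all_algebra.
From mathcomp Require Import all_classical all_reals all_analysis.
From mathcomp Require Import zify ring lra.
Set Implicit Arguments. Unset Strict Implicit. Unset Printing Implicit Defensive.
Import Order.TTheory GRing.Theory Num.Theory.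
Import numFieldNormedType.Exports.

(* On [1, p] an element of H^0(D)^(p^n) is, up to a fixed correction at the
   support of D, a convex function with slopes in p^-n Z, so it is given by a
   constant, a slope and a finite multiset of kinks; since principal divisors
   have degree 0, there are at most p^n deg D kinks, all of mass at least p^-n.

   Upper bound.  Choose K + 2 dyadic grids with pairwise disjoint shifts, where
   K is the maximal number of kinks.  The value at 1 and the kinks of f are at
   most K + 1 numbers, so one of the grids avoids them at every scale.  The
   slopes of f at the points of that grid are locally constant in f and
   determine f up to a small error, and the resulting cells are nested; hence
   maximal cells refine any open cover, and every point lies in at most one
   cell for each grid.

   Lower bound.  N + 1 kinks close to 1, with N + 1 within p of p^n deg D, may be
   moved freely inside a small N-cube if the last one keeps their sum constant,
   and their positions can be read off from values of f.  A cover of H^0(D)^(p^n)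
   that separates opposite faces of this cube has no refinement of order N, by
   Kuhn's cubical form of Sperner's lemma. *)

(** * Kuhn's lemma *)

(** A kink of mass [w] at [k] has order [k w]. Since [k > 1] and [w >= p^-n], each kink uses up more
    than [p^-n] of the degree, and nearly no more only when it is close to 1; this is why the kinks
    of the lower bound crowd at 1. Their number is not free: [f(p) = f(1)] fixes the initial slope
    in terms of the kinks, and its integrality prescribes the number of kinks modulo [p - 1], whence
    the loss of up to [p]. Neither bound is exact, but both errors are bounded independently of [n]
    and vanish after division by [p^n]. Adding constants preserves the space, so it is not compact
    once it contains a real-valued function, and the upper bound has to refine an arbitrary infinite
    cover. In negative degree only [-oo] is left. In all cases the limit is max(deg D, 0), and
    Riemann-Roch becomes the identity max(d, 0) - max(-d, 0) = d. *)

Section Kuhn.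
Variables (N m : nat).
Local Notation point := {ffun 'I_N -> nat}.
Local Notation corner := {ffun 'I_N -> 'I_m.+1}.

Definition step (v : point) (i : 'I_N) : point := [ffun k => v k + (k == i)].

(** For a permutation [s] of the axes these are the vertices of a simplex of Kuhn's triangulation of
    the unit cell at [v], in the order of the path from corner to opposite corner. *)
Fixpoint chain (v : point) (s : seq 'I_N) : seq point :=
  v :: if s is i :: s' then chain (step v i) s' else [::].

Lemma chain_cons v i s : chain v (i :: s) = v :: chain (step v i) s.
Proof. by []. Qed.

Lemma chainE v s : chain v s = v :: behead (chain v s).
Proof. by case: s. Qed.

Lemma size_chain v s : size (chain v s) = (size s).+1.
Proof. by elim: s v => //= i s IH v; rewrite IH. Qed.

Lemma chain_rcons v s i : exists w, chain v (rcons s i) = rcons (chain v s) w.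
Proof.
elim: s v => [|j s IH] v /=; first by exists (step v i).
by have [w ->] := IH (step v j); exists w.
Qed.

Lemma chain_mem v s w k : w \in chain v s -> v k <= w k <= v k + count_mem k s.
Proof.
elim: s v => [|i s IH] v /=; first by rewrite inE => /eqP ->; rewrite leq_addr leqnn.
rewrite inE => /orP[/eqP -> | /IH]; first by rewrite leqnn leq_addr.
by rewrite ffunE -addnA eq_sym => /andP[h1 ->]; rewrite (leq_trans _ h1) ?leq_addr.
Qed.

Definition nat_point (x : corner) : point := [ffun i => x i : nat].

Definition dropn (T : Type) j (s : seq T) := take j s ++ drop j.+1 s.

Lemma step_comm v i j : step (step v i) j = step (step v j) i.
Proof. by apply/ffunP => k; rewrite !ffunE addnAC. Qed.

Fixpoint swap (T : Type) j (s : seq T) :=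
  match j, s with
  | 0, a :: b :: s' => b :: a :: s'
  | j'.+1, a :: s' => a :: swap j' s'
  | _, _ => s
  end.

Lemma swapK (T : Type) j : involutive (@swap T j).
Proof.
elim: j => [|j IH] [|a s] //=; first by case: s.
by rewrite IH.
Qed.

Lemma perm_swap (T : eqType) j (s : seq T) : perm_eq (swap j s) s.
Proof.
elim: j s => [|j IH] [|a s] //=; last by rewrite perm_cons.
by case: s => // b s; rewrite (perm_catCA [:: b] [:: a]).
Qed.

(* An adjacent transposition at [j] changes only the vertex [j.+1] of the chain. *)
Lemma dropn_swap v j s : dropn j.+1 (chain v (swap j s)) = dropn j.+1 (chain v s).
Proof.
elim: j v s => [|j IH] v [|a s] //=.
  case: s => // b s; rewrite /dropn /= step_comm.
  by rewrite chainE [in RHS]chainE.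
by have := IH (step v a) s; rewrite /dropn /= => ->.
Qed.

Lemma nth_swap (T : Type) x0 j (s : seq T) : j.+1 < size s ->
  nth x0 (swap j s) j = nth x0 s j.+1 /\ nth x0 (swap j s) j.+1 = nth x0 s j.
Proof.
elim: j s => [|j IH] [|a s] //=; first by case: s.
by rewrite ltnS => /IH[].
Qed.

(** If some facet carries exactly the labels below [k] and the removed vertex carries [a], then the
    number of such facets is the multiplicity of [a] in [L]: one when [a = k], two when [a < k]. *)
Lemma rainbow_parity k (L : seq nat) : size L = k.+1 -> all (leq^~ k) L ->
  \big[addb/false]_(j < k.+1) perm_eq (dropn j L) (iota 0 k)
  = perm_eq L (iota 0 k.+1).
Proof.
move=> sL aL.
have dropE (j : nat) : j < k.+1 -> perm_eq L (nth 0 L j :: dropn j L).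
  move=> jk; rewrite -{1}(cat_take_drop j L) (drop_nth 0) ?sL //.
  by rewrite /dropn perm_sym -cat1s perm_catCA.
have odd_count (P : pred nat) (s : seq nat) :
    \big[addb/false]_(x <- s) P x = odd (count P s).
  elim: s => [|x s IH]; first by rewrite big_nil.
  by rewrite big_cons IH /= oddD oddb.
have [/existsP[j Pj]|/existsPn none] :=
    boolP [exists j : 'I_k.+1, perm_eq (dropn j L) (iota 0 k)].
  set a := nth 0 L j.
  have La : perm_eq L (a :: iota 0 k).
    by rewrite (perm_trans (dropE j (ltn_ord j))) // perm_cons.
  have -> : \big[addb/false]_(j < k.+1) perm_eq (dropn j L) (iota 0 k)
     = \big[addb/false]_(x <- L) (x == a).
    rewrite (big_nth 0) big_mkord sL; apply: eq_bigr => i _.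
    have Li := dropE i (ltn_ord i); apply/idP/eqP => [P | e].
      have : perm_eq (nth 0 L i :: iota 0 k) (a :: iota 0 k).
        by rewrite -(permPr La) perm_sym (permPl Li) perm_cons.
      by move=> /permP/(_ (pred1 a)) /=; rewrite eqxx => /addIn; case: eqVneq.
    by have := La; rewrite (permPl Li) e perm_cons.
  rewrite odd_count (permP La) [count _ _]/= eqxx oddD.
  have ak : a <= k by apply: (allP aL); rewrite mem_nth ?sL.
  rewrite count_uniq_mem ?iota_uniq // mem_iota add0n leq0n !oddb addTb.
  have -> : iota 0 k.+1 = rcons (iota 0 k) k by rewrite -addn1 iotaD cats1.
  rewrite (permPl La) perm_sym perm_rcons.
  have -> : perm_eq (k :: iota 0 k) (a :: iota 0 k) = (k == a).
    apply/idP/eqP => [/permP/(_ (pred1 k)) /=|->]; last exact: perm_refl.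
    by rewrite eqxx => /addIn; case: eqVneq.
  by rewrite ltn_neqAle ak andbT negbK eq_sym.
rewrite big1 => [|i _]; last exact/negbTE/none.
apply/esym/negbTE/negP => P.
have kL : k \in L by rewrite (perm_mem P) mem_iota add0n /=.
have ik : index k L < k.+1 by rewrite -sL index_mem.
have := none (Ordinal ik); case/negP => /=.
have := dropE _ ik; rewrite nth_index // => Q.
move: P; rewrite (permPl Q) -addn1 iotaD add0n cats1 perm_sym perm_rcons perm_cons perm_sym //.
Qed.

Variable lab : point -> nat.
Definition grid (v : point) := forall i, v i <= m.+1.
Hypothesis lab_bot : forall v i, grid v -> v i = 0 -> lab v <= i.
Hypothesis lab_top : forall v i, grid v -> v i = m.+1 -> lab v <> i.
Hypothesis lab_max : forall v, grid v -> lab v <= N.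

Definition coords k := take k (enum 'I_N).
Definition in_face k (x : corner) := [forall i : 'I_N, (k <= i) ==> (x i == ord0)].
Definition rainbow k (v : point) s := perm_eq (map lab (chain v s)) (iota 0 k.+1).
(** A sum for [addb]: the parity of the number of simplices labelled 0, ..., [k] in the face where
    all coordinates from [k] on vanish. *)
Definition rainbows k := \big[addb/false]_(x | in_face k x)
  \big[addb/false]_(s <- permutations (coords k)) rainbow k (nat_point x) s.

Lemma mem_coords k i : (i \in coords k) = (i < k).
Proof.
rewrite -(mem_map val_inj) /coords map_take val_enum_ord.
case: (leqP k N) => kN; first by rewrite take_iota mem_iota (minn_idPl kN).
rewrite take_oversize; last by rewrite size_iota ltnW.
by rewrite mem_iota /= add0n ltn_ord (ltn_trans (ltn_ord i)).
Qed.

Lemma coords_uniq k : uniq (coords k).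
Proof. by rewrite take_uniq ?enum_uniq. Qed.

Lemma size_coords k : k <= N -> size (coords k) = k.
Proof. by move=> kN; rewrite size_takel // size_enum_ord. Qed.

Lemma chain_face k x s v : perm_eq s (coords k) -> in_face k x ->
  v \in chain (nat_point x) s ->
  grid v /\ forall i : 'I_N, k <= i -> v i = 0.
Proof.
move=> ps /forallP fx vc.
have cs i : count_mem i s = (i < k).
  by rewrite (permP ps) count_uniq_mem ?coords_uniq // mem_coords.
split => i; have /andP[_] := chain_mem i vc; rewrite cs ffunE.
  by move/leq_trans; apply; have := ltn_ord (x i); have := leq_b1 (i < k); lia.
by move=> vi ki; move: vi (fx i); rewrite ltnNge ki /= addn0 => vi /eqP xi; move: vi;
  rewrite xi leqn0 => /eqP.
Qed.

Lemma big_addb_swap (I : Type) (r : seq I) (f : I -> I) (P F : I -> bool) :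
  \big[addb/false]_(i <- r | ~~ P i) F i = \big[addb/false]_(i <- r | P i) F i ->
  \big[addb/false]_(i <- r) F i = false.
Proof. by move=> e; rewrite (bigID P) /= e addbb. Qed.

(** A facet opposite an inner vertex of the path lies in exactly two simplices of the same cell,
    exchanged by [swap j]. Exactly one of the two permutations satisfies [P], so the contributions
    cancel. *)
Lemma sum_dropn_interior k j v : k < N -> j < k ->
  \big[addb/false]_(s <- permutations (coords k.+1))
     perm_eq (dropn j.+1 (map lab (chain v s))) (iota 0 k.+1) = false.
Proof.
move=> kN jk.
set A := permutations _; pose x0 := Ordinal kN.
pose P (s : seq 'I_N) := nth x0 s j < nth x0 s j.+1.
have sA s : s \in A -> size s = k.+1 /\ uniq s.
  rewrite mem_permutations => ps.
  by rewrite (perm_size ps) (perm_uniq ps) size_coords ?coords_uniq.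
have swapA : perm_eq (map (@swap _ j) A) A.
  apply: uniq_perm; rewrite ?(map_inj_uniq (inv_inj (@swapK _ j))) ?permutations_uniq //.
  move=> s; rewrite -{1}[s](@swapK _ j) mem_map ?mem_permutations //;
    last exact: inv_inj (@swapK _ j).
  by rewrite (permPl (perm_swap _ _)).
apply: (@big_addb_swap _ _ id P).
rewrite [LHS]big_seq_cond -(perm_big _ swapA) big_map [RHS]big_seq_cond.
have sw s : swap j s \in A = (s \in A).
  by rewrite !mem_permutations (permPl (perm_swap _ _)).
apply: congr_big => // s; last by move=> _;
  rewrite /dropn -!map_drop -!map_take -!map_cat -/(dropn _ _) dropn_swap.
rewrite sw; case: (boolP (s \in A)) => //= /sA[ss us].
have [|e1 e2] := @nth_swap _ x0 j s; first by rewrite ss ltnS.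
rewrite /P e1 e2 // -leqNgt leq_eqVlt val_eqE nth_uniq ?ss //; last by rewrite ltnW.
by rewrite (ltn_eqF (ltnSn j)).
Qed.

(** Translates of a facet along the axis [i] cancel between neighbouring cells. At the top, where
    coordinate [i] equals [m.+1], the label [i <= k] does not occur and no facet is rainbow, so only
    the bottom contributes. *)
Lemma sum_step_telescope k (i : 'I_N) t : i <= k -> k < N -> i \notin t ->
  t \in permutations (rem i (coords k.+1)) ->
  \big[addb/false]_(x | in_face k.+1 x)
     (rainbow k (step (nat_point x) i) t (+) rainbow k (nat_point x) t)
  = \big[addb/false]_(x | in_face k.+1 x && (x i == ord0)) rainbow k (nat_point x) t.
Proof.
move=> ik kN it tA; rewrite big_split /=.
have pt : perm_eq (i :: t) (coords k.+1).
  have ic : i \in coords k.+1 by rewrite mem_coords ltnS.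
  by rewrite perm_sym (perm_trans (perm_to_rem ic)) // perm_cons perm_sym -mem_permutations.
rewrite (bigID (fun x : corner => x i == ord_max)) /=.
rewrite big1 => [|x /andP[fx /eqP xi]]; last first.
  apply/negbTE/negP => /perm_mem/(_ (i : nat)); rewrite mem_iota /= add0n ltnS ik.
  move=> /mapP[v vc] /esym.
  have vc' : v \in chain (nat_point x) (i :: t) by rewrite chain_cons inE vc orbT.
  have [gv _] := chain_face pt fx vc'; apply: lab_top => //; apply/eqP.
  rewrite eqn_leq gv /=; have /andP[le _] := chain_mem i vc.
  by apply: leq_trans le; rewrite !ffunE eqxx xi /= addn1.
rewrite addFb [in RHS]big_mkcond [X in _ (+) X](bigID (fun x : corner => x i == ord0)) /=.
rewrite -big_mkcond /= [X in _ (+) X]addbC addbA.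
set S1 := \big[addb/false]_(x : corner | _ && (x i != ord_max)) _.
set S2 := \big[addb/false]_(x : corner | _ && (x i != ord0)) _.
suff -> : S1 = S2 by rewrite addbb addFb.
rewrite /S1 /S2.
pose up (x : corner) : corner := [ffun j => if j == i then inord (x j).+1 else x j].
pose dn (x : corner) : corner := [ffun j => if j == i then inord (x j).-1 else x j].
rewrite [RHS](@reindex_onto _ _ _ _ _ up dn); last first.
  move=> x /andP[_ xi]; apply/ffunP => j; rewrite !ffunE; case: eqP => // ->.
  apply: val_inj; rewrite /= !inordK; move: xi (ltn_ord (x i)); rewrite -val_eqE /=; lia.
apply: eq_big => [x|x /andP[_ xi]].
  have upi : x i != ord_max -> up x i = (x i).+1 :> nat.
    by move=> xi; rewrite ffunE eqxx inordK //; move: xi (ltn_ord (x i)); rewrite -val_eqE /=;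
      lia.
  rewrite -andbA; congr (_ && _).
    by apply: eq_forallb => j; rewrite ffunE; case: (j =P i) => // ->; rewrite ltnNge ik.
  apply/idP/andP => [xi|[]].
    split; first by rewrite -val_eqE /= upi.
    apply/eqP/ffunP => j; rewrite !ffunE; case: (j =P i) => // ->.
    by apply: val_inj; rewrite /= inordK inordK //; move: xi (ltn_ord (x i));
      rewrite -val_eqE /=; lia.
  rewrite ffunE eqxx; case: (x i =P ord_max) => // ->;
    by rewrite -val_eqE /= /inord val_insubd ltnn eqxx.
congr (rainbow _ _ _); apply/ffunP => j; rewrite !ffunE; case: eqVneq => [->|_] //.
  by rewrite inordK ?addn1 //; move: xi (ltn_ord (x i)); rewrite -val_eqE /=; lia.
by rewrite addn0.
Qed.

(** Double counting of the facets labelled 0, ..., [k]: inner facets cancel, and of the boundary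
    facets only those in the face where coordinate [k] vanishes survive. *)
Lemma rainbows_step k : k < N -> rainbows k.+1 = rainbows k.
Proof.
move=> kN; set A := permutations (coords k.+1).
pose F (j : nat) (x : corner) s :=
  perm_eq (dropn j (map lab (chain (nat_point x) s))) (iota 0 k.+1).
have ck i : i \in coords k.+1 -> i <= k by rewrite mem_coords ltnS.
have sA s : s \in A -> size s = k.+1.
  by rewrite mem_permutations => /perm_size ->; rewrite size_coords.
have sR i t : i \in coords k.+1 -> t \in permutations (rem i (coords k.+1)) ->
    i \notin t /\ size t = k.
  move=> ic; rewrite mem_permutations => pt.
  rewrite (perm_mem pt) (perm_size pt) mem_rem_uniqF ?coords_uniq //.
  by rewrite size_rem // size_coords.
transitivity (\big[addb/false]_(x | in_face k.+1 x)
    (\big[addb/false]_(s <- A) F 0 x s (+) \big[addb/false]_(s <- A) F k.+1 x s)).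
  apply: eq_bigr => x fx.
  transitivity (\big[addb/false]_(j < k.+2) \big[addb/false]_(s <- A) F j x s).
    rewrite exchange_big /= big_seq [RHS]big_seq; apply: eq_bigr => s sa.
    rewrite /rainbow -rainbow_parity ?size_map ?size_chain ?sA //.
    apply/allP => _ /mapP[v vc ->] /=.
    have [|gv v0] := chain_face _ fx vc; first by rewrite -mem_permutations.
    case: (ltnP k.+1 N) => kN'; first exact: (@lab_bot v (Ordinal kN') gv (v0 (Ordinal kN')
      (leqnn _))).
    exact: leq_trans (lab_max gv) kN'.
  rewrite big_ord_recl big_ord_recr /= [X in _ (+) (X (+) _)]big1 ?addFb // => j _.
  exact: sum_dropn_interior.
transitivity (\big[addb/false]_(x | in_face k.+1 x)
    \big[addb/false]_(i <- coords k.+1)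
    \big[addb/false]_(t <- permutations (rem i (coords k.+1)))
       (rainbow k (step (nat_point x) i) t (+) rainbow k (nat_point x) t)).
  apply: eq_bigr => x fx.
  (* The facet opposite the first vertex of [i :: t] and that opposite the last vertex of
     [rcons t i] are translates of each other along [i]; rotating the second sum pairs them. *)
  have rotA : perm_eq (map (rot 1) A) A.
    apply: uniq_perm; rewrite ?(map_inj_uniq (@rot_inj 1 _)) ?permutations_uniq //.
    move=> s; rewrite -{1}[s](rotrK 1) mem_map ?mem_permutations //; last exact: rot_inj.
    by rewrite perm_rotr.
  rewrite -[X in _ (+) X](perm_big _ rotA) big_map -big_split /=.
  have c0 : 0 < size (coords k.+1) by rewrite size_coords.
  rewrite (perm_big _ (permutationsE c0)) big_allpairs_dep undup_id ?coords_uniq //.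
  rewrite big_seq [RHS]big_seq; apply: eq_bigr => i ic.
  rewrite big_seq [RHS]big_seq; apply: eq_bigr => t tA.
  have [it st] := sR i t ic tA.
  congr (_ (+) _); rewrite /F; first by rewrite /dropn /= drop0.
  rewrite rot1_cons; have [w ->] := chain_rcons (nat_point x) t i.
  rewrite map_rcons /dropn -cats1 take_cat drop_cat size_map size_chain st ltnn ltnNge leqnSn /=.
  by rewrite subnn subSnn !cats0.
rewrite exchange_big /=; transitivity (\big[addb/false]_(i <- coords k.+1)
    \big[addb/false]_(t <- permutations (rem i (coords k.+1)))
     (if i == k :> nat then \big[addb/false]_(x | in_face k x) rainbow k (nat_point x) t
      else false)).
  rewrite big_seq [RHS]big_seq; apply: eq_bigr => i ic.
  rewrite exchange_big big_seq [RHS]big_seq /=; apply: eq_bigr => t tA.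
  have [it st] := sR i t ic tA.
  rewrite sum_step_telescope ?ck //; case: (i =P k :> nat) => [ik|/eqP ik].
    apply: eq_bigl => x; apply/andP/forallP => [[/forallP fx xi] j | fx].
      apply/implyP; rewrite leq_eqVlt -ik => /orP[/eqP/val_inj <- //|].
      by move=> ij; have := fx j; rewrite -ik ij.
    split; last by have := fx i; rewrite ik leqnn.
    by apply/forallP => j; apply/implyP => kj; have := fx j; rewrite (ltnW kj).
  (* On a bottom face with [i < k] all labels are at most [i], so the label [k] is missing. *)
  have {}ik : i < k by rewrite ltn_neqAle ik ck.
  rewrite big1 // => x /andP[fx /eqP xi].
  apply/negbTE/negP => /perm_mem/(_ k); rewrite mem_iota /= add0n ltnSn.
  move=> /mapP[v vc] kv.
  have vc' : v \in chain (nat_point x) (rcons t i).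
    have [w ->] := chain_rcons (nat_point x) t i.
    by rewrite mem_rcons inE vc orbT.
  have [|gv _] := chain_face _ fx vc'.
    rewrite mem_permutations in tA.
    by rewrite perm_rcons perm_sym (perm_trans (perm_to_rem ic)) // perm_cons perm_sym.
  have /andP[_] := chain_mem i vc; rewrite (count_memPn it) ffunE xi /= leqn0 => /eqP vi.
  by have := lab_bot gv vi; rewrite -kv leqNgt ik.
pose ik := Ordinal kN.
rewrite (bigD1_seq ik) ?mem_coords ?coords_uniq //= eqxx.
rewrite [X in _ (+) X]big1_seq ?addbF => [|i /andP[ii _]]; last first.
  by apply: big1 => t _; rewrite -[k]/(val ik) val_eqE (negbTE ii).
rewrite exchange_big; apply: eq_bigr => x _; apply: perm_big; apply: perm_permutations.
apply: uniq_perm; rewrite ?rem_uniq ?coords_uniq // => j.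
by rewrite mem_rem_uniq ?coords_uniq // !inE !mem_coords -val_eqE /= ltnS ltn_neqAle.
Qed.

Lemma rainbows_odd k : k <= N -> rainbows k.
Proof.
elim: k => [|k IH] kN; last by rewrite rainbows_step ?IH // ltnW.
rewrite /rainbows (big_pred1 [ffun=> ord0]) /=; last first.
  move=> x; apply/forallP/eqP => [fx | -> i]; last by rewrite ffunE.
  by apply/ffunP => i; rewrite ffunE; apply/eqP; exact: fx.
rewrite /coords take0 big_seq1 /rainbow /=.
set v := nat_point _.
have gv : grid v by move=> i; rewrite !ffunE.
suff -> : lab v = 0 by [].
case: (posnP N) => [N0|N0]; first by have := lab_max gv; rewrite N0 leqn0 => /eqP.
have := @lab_bot v (Ordinal N0) gv; rewrite !ffunE leqn0 => h; exact/eqP/h.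
Qed.

Theorem kuhn : exists x : corner, forall c, c <= N -> exists v : point,
  lab v = c /\ forall i, x i <= v i <= (x i).+1.
Proof.
have := rainbows_odd (leqnn N); rewrite /rainbows.
have [/existsP[x /hasP[s sP rb]] _|/existsPn none] :=
  boolP [exists x : corner, has (rainbow N (nat_point x)) (permutations (coords N))].
  exists x => c cN; have : c \in iota 0 N.+1 by rewrite mem_iota.
  rewrite -(perm_mem rb) => /mapP[v vc ->]; exists v; split => // i.
  have /andP[h1 h2] := chain_mem i vc; rewrite ffunE in h1 h2.
  rewrite h1 /= (leq_trans h2) // -[leqRHS]addn1 leq_add2l.
  rewrite mem_permutations in sP.
  by rewrite (permP sP) count_uniq_mem ?coords_uniq ?leq_b1.
rewrite big1 // => x _; rewrite big_seq big1 // => s sA.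
by apply/negbTE/negP => rb; have /hasP := none x; case; exists s.
Qed.

End Kuhn.

Local Open Scope classical_set_scope.
Local Open Scope ring_scope.

(** * Lower bounds for the covering dimension *)

Section CubeCovers.
Variables (R : realType) (N : nat).

Definition cube : set 'rV[R]_N := [set v | forall i, 0 <= v ord0 i <= 1].

Lemma compact_cube : compact cube.
Proof.
rewrite (_ : cube = [set v : 'rV[R]_N | forall i, `[0, 1]%classic (v ord0 i)]).
  by apply: (@rV_compact R N (fun=> `[0, 1]%classic)) => i; exact: segment_compact.
by apply/seteqP; split => v /= vK i; have := vK i; rewrite in_itv.
Qed.

Lemma cube_lebesgue_number (J : Type) (V : J -> 'rV[R]_N -> Prop) :
  (forall x, cube x -> exists j (e : R), 0 < e /\
     forall y, cube y -> (forall i, `|x ord0 i - y ord0 i| < e) -> V j y) ->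
  exists e : R, 0 < e /\ forall x, cube x -> exists j,
     forall y, cube y -> (forall i, `|x ord0 i - y ord0 i| < e) -> V j y.
Proof.
move=> covV; have /compact_near_coveringP cK := compact_cube.
pose P (e : R) (x : 'rV[R]_N) := exists j, forall y, cube y ->
  (forall i, `|x ord0 i - y ord0 i| < e) -> V j y.
have : \forall e \near (0 : R)^'+, cube `<=` P e.
  apply: cK => x /covV[j [e [e0 Ve]]].
  have e20 : 0 < e / 2 by rewrite divr_gt0.
  exists (ball x (e / 2), [set d | d < e / 2]).
    split; first exact: nbhsx_ballx.
    exact: nbhs_right_lt.
  move=> [x' d] /= [xx' de]; exists j => y Ky xy; apply: Ve => // i.
  case: xx' => _ /(_ ord0 i); rewrite /ball /= => xx'i; have := xy i.
  move: xx'i de; rewrite !ltr_norml; lra.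
move=> H; have : \forall e \near (0 : R)^'+, cube `<=` P e /\ 0 < e.
  by apply: filterI H _; exact: nbhs_right_gt.
by move=> H'; have [e [Pe e0]] := @filter_ex _ _ (at_right_proper_filter 0) _ H'; exists e.
Qed.

End CubeCovers.

Section LowerBound.
Variables (R : realType) (T : Type) (dl : T -> T -> R -> Prop) (X : set T).
Variables (N : nat) (sigma : 'rV[R]_N -> T) (phi : 'I_N -> T -> R).
Hypothesis sigmaX : forall x, cube x -> X (sigma x).
Hypothesis sigma_cont : forall x, cube x -> forall e, 0 < e -> exists d, 0 < d /\
  forall y, cube y -> (forall i, `|x ord0 i - y ord0 i| < d) -> dl (sigma x) (sigma y) e.
Hypothesis phi_cont : forall t, X t -> forall e, 0 < e -> exists d, 0 < d /\
  forall u, X u -> dl t u d -> forall i, `|phi i t - phi i u| < e.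
Hypothesis phi_sigma : forall x i, cube x -> phi i (sigma x) = x ord0 i.

Lemma cover_order_ge_cube k : cover_order_le dl X k -> (N < k)%N.
Proof.
(* For each [i], [U b] misses one of the two opposite faces: the one with coordinate 0 if [b i],
   otherwise the one with coordinate 1. *)
pose U (b : {ffun 'I_N -> bool}) : set T :=
  [set t | X t /\ forall i, if b i then 0 < phi i t else phi i t < 1].
have U_open b : sub_open dl X (U b).
  split=> [t []//|t [Xt Ut]].
  pose m i := if b i then phi i t else 1 - phi i t.
  have m0 i : 0 < m i by rewrite /m; have := Ut i; case: (b i) => //; rewrite subr_gt0.
  pose e := \big[Num.min/1]_i m i.
  have e0 : 0 < e by rewrite /e; elim/big_ind: _ => // x y x0 y0; rewrite lt_min x0.
  have em i : e <= m i by rewrite /e (bigD1 i) //= ge_min lexx.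
  have [d [d0 He]] := phi_cont Xt e0; exists d; split => // u Xu /(He _ Xu) tu.
  split => // i; have := tu i; have := em i; rewrite ltr_norml /m; case: (b i); lra.
move=> /(_ [set V | exists b, V = U b]) [|C' [[C'o C'c] [C'r C'k]]].
  split=> [_ [b ->]//|t Xt]; exists (U [ffun i => 1 <= phi i t]); split; first by eexists.
  split=> // i; rewrite ffunE; by case: (leP 1 (phi i t)) => // h; apply: lt_le_trans h.
pose b (V : set T) i := `[< exists x, [/\ cube x, x ord0 i = 1 & V (sigma x)] >].
have bP V i x : C' V -> cube x -> V (sigma x) -> x ord0 i = 0 -> ~~ b V i.
  move=> /C'r[_ [[c ->] VU]] Kx /VU[_ /(_ i)]; rewrite phi_sigma // => ci x0.
  apply/negP => /asboolP[y [Ky y1 /VU[_ /(_ i)]]]; rewrite phi_sigma // y1.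
  by move: ci; rewrite x0; case: (c i); rewrite ltxx.
(* The label of a point depends only on the member [V] of the cover chosen for it,
   so that a rainbow cell yields [N.+1] distinct members. *)
pose label V := find (fun i => ~~ b V i) (enum 'I_N).
have label_le V i : ~~ b V i -> (label V <= i)%N.
  move=> nb; rewrite leqNgt; apply/negP => /(before_find i).
  by rewrite nth_ord_enum nb.
have label_neq V i : b V i -> label V <> i.
  move=> bi Vi; have : has (fun i => ~~ b V i) (enum 'I_N).
    by rewrite has_find -/(label V) Vi size_enum_ord.
  by move/(nth_find i); rewrite -/(label V) Vi nth_ord_enum bi.
have [|e [e0 He]] := @cube_lebesgue_number R N (set T) (fun V y => C' V /\ V (sigma y)).
  move=> x Kx; have [V [C'V Vx]] := C'c _ (sigmaX Kx).
  have [_ /(_ _ Vx)[e [e0 Ve]]] := C'o _ C'V.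
  have [d [d0 Hd]] := sigma_cont Kx e0.
  exists V, d; split => // y Ky /(Hd _ Ky) xy; split=> //; exact: Ve (sigmaX Ky) xy.
have [m me] : exists m : nat, m.+1%:R^-1 < e.
  exists (Num.truncn e^-1); rewrite invf_plt ?posrE //; exact: truncnS_gt.
pose pt (v : {ffun 'I_N -> nat}) : 'rV[R]_N := \row_i ((v i)%:R / m.+1%:R).
have ptK v : grid m v -> cube (pt v).
  move=> gv i; rewrite mxE divr_ge0 //= ler_pdivrMr // mul1r ler_nat; exact: gv.
(* [Vof v] contains the images of all points of the cube within [e] of [pt v], and cells are smaller
   than [e]. Hence the members chosen at all vertices of a cell contain the image of its lowest
   corner. *)
have /choice[Vof VofP] : forall v, exists V, grid m v -> forall y, cube y ->
    (forall i, `|pt v ord0 i - y ord0 i| < e) -> C' V /\ V (sigma y).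
  move=> v; case: (pselect (grid m v)) => [gv|ngv]; last by exists setT.
  by have [V HV] := He _ (ptK _ gv); exists V.
have VofV v : grid m v -> C' (Vof v) /\ Vof v (sigma (pt v)).
  by move=> gv; apply: VofP => // [|i]; [exact: ptK|rewrite subrr normr0].
have [||v gv|x Hx] := @kuhn N m (label \o Vof).
- move=> v i gv vi; have [C'V Vs] := VofV v gv.
  by apply/label_le/(bP _ _ _ C'V (ptK _ gv) Vs); rewrite mxE vi mul0r.
- move=> v i gv vi; have [C'V Vs] := VofV v gv; apply: label_neq.
  by apply/asboolP; exists (pt v); split; [exact: ptK|rewrite mxE vi divff|].
- by rewrite /= -[leqRHS](size_enum_ord N) find_size.
have Hx' c : exists v : {ffun 'I_N -> nat}, (c <= N)%N -> label (Vof v) = c /\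
    forall i, (x i <= v i <= (x i).+1)%N.
  case: (leqP c N) => [/Hx[v Hv]|_]; last by exists (nat_point x).
  by exists v.
have [vx vxP] := choice Hx'.
pose x0 := pt (nat_point x).
have gx0 : grid m (nat_point x) by move=> i; rewrite ffunE ltnW.
rewrite ltnNge; apply/negP => kN.
have [|i [j [/andP[ij jk]]]] := C'k _ (sigmaX (ptK _ gx0)) (Vof \o vx).
  move=> i ik; have iN : (i <= N)%N by apply: leq_trans kN.
  have [_ vi] := vxP i iN; apply: VofP; [|exact: ptK|].
    by move=> l; have /andP[_ h] := vi l; apply: leq_trans h _.
  move=> l; apply: le_lt_trans me; rewrite !mxE ffunE -mulrBl normrM normfV.
  rewrite [X in _ / X]ger0_norm // -[leRHS]mul1r ler_wpM2r ?invr_ge0 //.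
  have /andP[h1 h2] := vi l; rewrite -natrB // ger0_norm // -[1]/(1%:R) ler_nat; lia.
move=> /(congr1 label) /=; have jN : (j <= N)%N by apply: leq_trans kN.
have [-> _] := vxP j jN; have [-> _] := vxP i (leq_trans (ltnW ij) jN).
by move=> e1; rewrite e1 ltnn in ij.
Qed.

End LowerBound.

(** * One-sided slopes *)

Section LocalSlopes.
Variable R : realType.
Implicit Types (f g : R -> R) (l s : R).

(** Exactly affine on a one-sided neighbourhood, so that the limits defining [rslope], [hplus] and
    their left versions are limits of eventually constant functions. *)
Definition raff f l s := exists d : R, 0 < d /\
  forall x, l <= x <= l + d -> f x = f l + s * (x - l).
Definition laff f l s := exists d : R, 0 < d /\
  forall x, l - d <= x <= l -> f x = f l + s * (x - l).

Lemma raff_rslope f l s : raff f l s -> rslope f l = s.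
Proof.
move=> [d [d0 fE]]; apply: cvg_lim => //; apply: cvg_near_cst.
near=> x.
have lx : l < x by near: x; exact: nbhs_right_gt.
have xd : x < l + d by near: x; apply: nbhs_right_lt; rewrite ltrDl.
rewrite fE ?(ltW lx) ?(ltW xd) // addrAC subrr add0r mulfK // subr_eq0 gt_eqF //.
Unshelve. all: by end_near. Qed.

Lemma laff_lslope f l s : laff f l s -> lslope f l = s.
Proof.
move=> [d [d0 fE]]; apply: cvg_lim => //; apply: cvg_near_cst.
near=> x.
have lx : x < l by near: x; exact: nbhs_left_lt.
have xd : l - d < x by near: x; apply: nbhs_left_gt; rewrite ltrBlDr ltrDl.
rewrite fE ?(ltW lx) ?(ltW xd) // addrAC subrr add0r mulfK // subr_eq0 lt_eqF //.
Unshelve. all: by end_near. Qed.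

Lemma raff_hplus f l s : 0 < l -> raff f l s -> hplus f l = l * s.
Proof.
move=> l0 [d [d0 fE]]; apply: cvg_lim => //; apply: cvg_near_cst.
near=> e.
have e0 : 0 < e by near: e; exact: nbhs_right_gt.
have ed : e < d / l by near: e; apply: nbhs_right_lt; rewrite divr_gt0.
have el : 0 <= e * l <= d.
  by apply/andP; split; [rewrite mulr_ge0 // ltW|rewrite -ler_pdivlMr // ltW].
rewrite fE; last by move: el; lra.
by field; rewrite gt_eqF.
Unshelve. all: by end_near. Qed.

Lemma laff_hminus f l s : 0 < l -> laff f l s -> hminus f l = l * s.
Proof.
move=> l0 [d [d0 fE]]; apply: cvg_lim => //; apply: cvg_near_cst.
near=> e.
have e0 : e < 0 by near: e; exact: nbhs_left_lt.
have ed : - (d / l) < e by near: e; apply: nbhs_left_gt; rewrite oppr_lt0 divr_gt0.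
have el : - d <= e * l <= 0.
  by apply/andP; split; [rewrite -ler_pdivrMr // mulNr ltW|rewrite nmulr_rle0 // ltW].
rewrite fE; last by move: el; lra.
by field; rewrite lt_eqF.
Unshelve. all: by end_near. Qed.

Lemma raff_inj f l s t : raff f l s -> raff f l t -> s = t.
Proof. by move=> /raff_rslope <- /raff_rslope <-. Qed.

Lemma laff_inj f l s t : laff f l s -> laff f l t -> s = t.
Proof. by move=> /laff_lslope <- /laff_lslope <-. Qed.

Lemma raffD f g l s t : raff f l s -> raff g l t -> raff (fun x => f x + g x) l (s + t).
Proof.
move=> [d [d0 fE]] [e [e0 gE]]; exists (Num.min d e); split; first by rewrite lt_min d0.
move=> x /andP[lx]; rewrite -lerBlDl le_min !lerBlDl => /andP[xd xe].
by rewrite fE ?lx // gE ?lx //; ring.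
Qed.

Lemma laffD f g l s t : laff f l s -> laff g l t -> laff (fun x => f x + g x) l (s + t).
Proof.
move=> [d [d0 fE]] [e [e0 gE]]; exists (Num.min d e); split; first by rewrite lt_min d0.
move=> x /andP[+ xl]; rewrite lerBlDl -lerBlDr le_min !lerBlDr -!lerBlDl => /andP[xd xe].
by rewrite fE ?xl ?andbT // gE ?xl ?andbT //; ring.
Qed.

Lemma raffZ f l s c : raff f l s -> raff (fun x => c * f x) l (c * s).
Proof. by move=> [d [d0 fE]]; exists d; split => // x /fE ->; ring. Qed.

Lemma laffZ f l s c : laff f l s -> laff (fun x => c * f x) l (c * s).
Proof. by move=> [d [d0 fE]]; exists d; split => // x /fE ->; ring. Qed.

Lemma raff_eq f g l s (d : R) : 0 < d -> (forall x, l <= x <= l + d -> f x = g x) ->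
  raff f l s -> raff g l s.
Proof.
move=> d0 fg [e [e0 fE]]; exists (Num.min d e); split; first by rewrite lt_min d0.
move=> x /andP[lx]; rewrite -lerBlDl le_min !lerBlDl => /andP[xd xe].
rewrite -fg ?lx // -fg ?lexx ?lerDl ?(ltW d0) // fE ?lx //.
Qed.

Lemma laff_eq f g l s (d : R) : 0 < d -> (forall x, l - d <= x <= l -> f x = g x) ->
  laff f l s -> laff g l s.
Proof.
move=> d0 fg [e [e0 fE]]; exists (Num.min d e); split; first by rewrite lt_min d0.
move=> x /andP[+ xl]; rewrite lerBlDl -lerBlDr le_min !lerBlDr -!lerBlDl => /andP[xd xe].
rewrite -fg ?xl ?andbT // -fg ?lexx ?gerBl ?(ltW d0) // fE ?xl ?andbT //.
Qed.

Definition hinge (k x : R) : R := Num.max (x - k) 0.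

Lemma hinge_right k x : k <= x -> hinge k x = x - k.
Proof. by move=> kx; rewrite /hinge max_l // subr_ge0. Qed.

Lemma hinge_left k x : x <= k -> hinge k x = 0.
Proof. by move=> kx; rewrite /hinge max_r // subr_le0. Qed.

Lemma hinge_ge0 k x : 0 <= hinge k x.
Proof. by rewrite /hinge le_max lexx orbT. Qed.

Lemma raff_hinge k l : raff (hinge k) l (k <= l)%R%:R.
Proof.
case: (leP k l) => kl /=.
  exists 1; split => // x /andP[lx _].
  by rewrite !hinge_right // ?(le_trans kl) //; ring.
exists (k - l); split => [|x]; first by rewrite subr_gt0.
rewrite addrC subrK => /andP[_ xk]; rewrite !hinge_left // ?(ltW kl) //; ring.
Qed.

Lemma laff_hinge k l : laff (hinge k) l (k < l)%R%:R.
Proof.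
case: (leP l k) => kl /=.
  exists 1; split => // x /andP[_ xl].
  by rewrite !hinge_left // ?(le_trans xl) //; ring.
exists (l - k); split => [|x]; first by rewrite subr_gt0.
rewrite opprB addrC subrK => /andP[kx _].
by rewrite !hinge_right // ?(ltW kl) //; ring.
Qed.

(** The entries of [ws] are pairs of a mass and a position, unsorted and with repetitions allowed.
    If all positions are at least 1, then [c] is the value at 1; if they exceed 1, [a] is the right
    slope there. *)
Definition bend (c a : R) (ws : seq (R * R)) (x : R) : R :=
  c + a * (x - 1) + \sum_(w <- ws) w.1 * hinge w.2 x.

Lemma raff_bend c a ws l : raff (bend c a ws) l (a + \sum_(w <- ws | w.2 <= l) w.1).
Proof.
elim: ws => [|w ws IH].
  rewrite /bend big_nil addr0; exists 1; split => // x _; rewrite !big_nil; ring.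
have := raffD IH (raffZ w.1 (raff_hinge w.2 l)).
rewrite big_cons => h; suff -> : bend c a (w :: ws) =
    (fun x => bend c a ws x + w.1 * hinge w.2 x).
  by congr raff : h; case: ifP => _ /=; ring.
by apply/funext => x; rewrite /bend big_cons; ring.
Qed.

Lemma laff_bend c a ws l : laff (bend c a ws) l (a + \sum_(w <- ws | w.2 < l) w.1).
Proof.
elim: ws => [|w ws IH].
  rewrite /bend big_nil addr0; exists 1; split => // x _; rewrite !big_nil; ring.
have := laffD IH (laffZ w.1 (laff_hinge w.2 l)).
rewrite big_cons => h; suff -> : bend c a (w :: ws) =
    (fun x => bend c a ws x + w.1 * hinge w.2 x).
  by congr laff : h; case: ifP => _ /=; ring.
by apply/funext => x; rewrite /bend big_cons; ring.
Qed.

End LocalSlopes.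

(** * Upper bounds for the covering dimension *)

Section ColoredCovers.
Variables (R : realType) (T : Type) (dl : T -> T -> R -> Prop) (X : set T) (k : nat).
(** For a color [c] and a level [m], only a partial equivalence: [E c m t t] says that [t] lies in
    some cell of that color and level. Points on the walls between cells lie in none. *)
Variable E : nat -> nat -> T -> T -> Prop.
Hypothesis E_sym : forall c m t u, E c m t u -> E c m u t.
Hypothesis E_trans : forall c m t u v, E c m t u -> E c m u v -> E c m t v.
Hypothesis E_mono : forall c m n t u, (m <= n)%N -> E c n t u -> E c m t u.
Hypothesis E_open : forall c m t u, X t -> X u -> E c m t u ->
  exists e, 0 < e /\ forall v, X v -> dl u v e -> E c m t v.
Hypothesis E_fine : forall t, X t -> exists2 c, (c < k)%N & forall e, 0 < e ->
  exists2 m, E c m t t & forall u, X u -> E c m t u -> dl t u e.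

Let cls c m t : set T := [set u | X u /\ E c m t u].

(* For each color the classes of all levels are nested, so that the maximal
   ones contained in a member of the given cover are pairwise disjoint. *)
Lemma cover_order_colored : cover_order_le dl X k.
Proof.
move=> C [C_open C_cov].
pose sub V := exists U, C U /\ V `<=` U.
pose C' : set (set T) := [set V | sub V /\ exists c m t, [/\ (c < k)%N, X t, E c m t t,
   V = cls c m t & forall m', (m' < m)%N -> ~ sub (cls c m' t)]].
have clsE c m t u : E c m t u -> cls c m t = cls c m u.
  move=> tu; apply/seteqP; split => v [Xv h]; split => //; last exact: E_trans h.
  exact: E_trans (E_sym tu) h.
exists C'; split; [split|split].
- move=> _ [_ [c [m [t [ck Xt tt -> _]]]]]; split=> [u []//|u [Xu tu]].
  have [e [e0 He]] := E_open Xt Xu tu; exists e; split => // v Xv uv; split => //; exact: He.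
- move=> t Xt; have [U [CU Ut]] := C_cov t Xt; have [c ck fine_t] := E_fine Xt.
  have [_ /(_ _ Ut)[e [e0 He]]] := C_open _ CU; have [m Em Hm] := fine_t e e0.
  have : exists m, `[< E c m t t /\ sub (cls c m t) >].
    exists m; apply/asboolP; split => //; exists U; split => // u [Xu /(Hm _ Xu) tu]; exact: He.
  move=> /ex_minnP[n /asboolP[En sn] n_min].
  exists (cls c n t); split; last by [].
  split=> //; exists c, n, t; split => // n' n'n sn'.
  suff : (n <= n')%N by rewrite leqNgt n'n.
  apply: n_min; apply/asboolP; split => //; exact: E_mono (ltnW n'n) En.
- by move=> V [[U [CU VU]] _]; exists U.
move=> t Xt W HW.
have /choice[c Hc] : forall i : 'I_k.+1, exists c : 'I_k, exists m u, [/\ X u,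
   W i = cls c m u & forall m', (m' < m)%N -> ~ sub (cls c m' u)].
  move=> i; have [[_ [c [m [u [ck Xu _ Wi mi]]]]] _] := HW i (ltn_ord i).
  by exists (Ordinal ck), m, u.
have : ~~ injectiveb c.
  by apply/injectiveP => /leq_card; rewrite !card_ord ltnn.
move=> /injectivePn[i [j ij cij]].
wlog lt_ij : i j ij cij / (i < j)%N.
  move=> H; case: (ltngtP i j) => [||/val_inj e]; [exact: H| |by rewrite e eqxx in ij].
  by apply: H; rewrite // eq_sym.
exists i, j; split; first by rewrite lt_ij ltn_ord.
have [_ Wit] := HW i (ltn_ord i); have [_ Wjt] := HW j (ltn_ord j).
have [sWi _] := (HW i (ltn_ord i)).1; have [sWj _] := (HW j (ltn_ord j)).1.
have [m [u [Xu Wi mi]]] := Hc i; have [n [v [Xv Wj mj]]] := Hc j.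
rewrite Wi Wj -{}cij in Wit Wjt sWi sWj mj *.
move: (c i) Wit Wjt sWi sWj mi mj => d [_ ut] [_ vt] sWi sWj mi mj.
(* Two classes of one color through [t]: were the levels different, the coarser class would also be
   the class of the other center at the smaller level and lie in a member of [C], against
   minimality. *)
case: (ltngtP m n) => [mn|nm|mn]; last by subst n; rewrite (clsE _ _ _ _ ut) (clsE _ _ _ _ vt).
  case: (mj _ mn); have vt' := E_mono (ltnW mn) vt.
  by rewrite (clsE _ _ _ _ vt') -(clsE _ _ _ _ ut).
case: (mi _ nm); have ut' := E_mono (ltnW nm) ut.
by rewrite (clsE _ _ _ _ ut') -(clsE _ _ _ _ vt).
Qed.

End ColoredCovers.

(** * Shifted dyadic grids *)

Section Grids.
Variables (R : realType) (q : nat).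
Hypothesis q_odd : odd q.

(* As [q] is odd, the shifts [c / q] with [c < q] are distinct modulo dyadic
   rationals, so that a point lies on grids of at most one color [c]. *)
Definition on_grid (c m : nat) (x : R) : Prop :=
  exists j : int, x = c%:R / q%:R + j%:~R / 2 ^+ m.

Let q0 : q%:R != 0 :> R.
Proof. by rewrite pnatr_eq0; case: q q_odd. Qed.

Lemma on_grid_inj c c' m m' x : (c < q)%N -> (c' < q)%N ->
  on_grid c m x -> on_grid c' m' x -> c = c'.
Proof.
move=> cq c'q [j ->] [j' E].
have {}E : (c%:Z - c'%:Z) * 2 ^+ (m + m') = (j' * 2 ^+ m - j * 2 ^+ m') * q%:Z.
  apply/eqP; rewrite -(eqr_int R) !rmorphM !rmorphB /= !rmorphM !rmorphXn !rmorph_nat /=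
    -!pmulrn; apply/eqP.
  have -> : j%:~R = (c'%:R / q%:R + j'%:~R / 2 ^+ m' - c%:R / q%:R) * 2 ^+ m :> R.
    by rewrite -E addrAC subrr add0r divfK // expf_neq0.
  rewrite exprD; field; rewrite q0 !expf_neq0 //.
have : (q%:Z %| (c%:Z - c'%:Z) * 2 ^+ (m + m'))%Z by rewrite E dvdz_mull.
rewrite Gauss_dvdzl; last by rewrite coprimezXr // coprimezE coprimen2.
move=> /dvdzP[z Ez]; have : z = 0 by nia.
move=> z0; move: Ez; rewrite z0 mul0r; lia.
Qed.

Lemma on_grid_mono c m n x : (m <= n)%N -> on_grid c m x -> on_grid c n x.
Proof.
move=> mn [j ->]; exists (j * 2 ^+ (n - m)); rewrite rmorphM rmorphXn /=.
rewrite -{2}(subnK mn) exprD; field; rewrite q0 !expf_neq0 //.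
Qed.

Lemma on_grid_next c m x : exists2 e, on_grid c m e & x < e <= x + 2 ^- m.
Proof.
set z := (x - c%:R / q%:R) * 2 ^+ m.
exists (c%:R / q%:R + (Num.floor z + 1)%:~R / 2 ^+ m); first by eexists.
have m0 : 0 < 2 ^+ m :> R by rewrite exprn_gt0.
have xE : x = c%:R / q%:R + z / 2 ^+ m by rewrite /z; field; rewrite q0 expf_neq0.
have /andP[h1 h2] := real_floor_itv (num_real z).
rewrite {1 2}xE -addrA ltrD2l lerD2l ltr_pdivrMr // divfK ?gt_eqF // h2 /=.
rewrite -[X in _ <= _ + X]mul1r -mulrDl ler_pM2r ?invr_gt0 // rmorphD /= lerD2r //.
Qed.

Lemma int_isolated (z : R) : exists2 d : R, 0 < d & forall i : int, i%:~R != z -> d <= `|i%:~R -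
  z|.
Proof.
have /andP[h1 h2] := real_floor_itv (num_real z); set j := Num.floor z in h1 h2.
exists (if z == j%:~R then 1 else Num.min (z - j%:~R) ((j + 1)%:~R - z)).
  case: eqVneq => // zj; rewrite lt_min !subr_gt0 h2 andbT lt_neqAle h1 andbT eq_sym //.
move=> i iz; case: eqVneq => [zj|zj].
  by rewrite zj -rmorphB -intr_norm -[1]/(1%:~R) ler_int; move: iz; rewrite zj eqr_int; lia.
rewrite ge_min; case: (leP i j) => ij.
  rewrite distrC ger0_norm ?lerD2l ?lerN2 ?ler_int ?ij // subr_ge0 (le_trans _ h1) // ler_int //.
have ij' : (j + 1)%:~R <= i%:~R :> R by rewrite ler_int; lia.
rewrite orbC ger0_norm ?lerD2r ?ij' // subr_ge0 (le_trans (ltW h2)) //.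
Qed.

Lemma on_grid_isolated c m x : exists2 d : R, 0 < d &
  forall e, on_grid c m e -> e != x -> d <= `|e - x|.
Proof.
have [d d0 Hd] := int_isolated ((x - c%:R / q%:R) * 2 ^+ m).
have m0 : 0 < 2 ^+ m :> R by rewrite exprn_gt0.
exists (d / 2 ^+ m) => [|_ [j ->] jx]; first by rewrite divr_gt0.
have E : c%:R / q%:R + j%:~R / 2 ^+ m - x = (j%:~R - (x - c%:R / q%:R) * 2 ^+ m) / 2 ^+ m.
  by field; rewrite q0 gt_eqF.
rewrite E normrM [X in _ <= _ * X]ger0_norm; last by rewrite invr_ge0 ltW.
rewrite ler_pM2r ?invr_gt0 //.
apply: Hd; rewrite -subr_eq0; move: jx; rewrite -subr_eq0 E mulf_eq0 invr_eq0 (gt_eqF m0) orbF //.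
Qed.

Lemma on_grid_isolated_seq c m (s : seq R) : exists2 d : R, 0 < d &
  forall x e, x \in s -> on_grid c m e -> e != x -> d <= `|e - x|.
Proof.
elim: s => [|x s [d d0 Hd]]; first by exists 1.
have [d' d'0 Hd'] := on_grid_isolated c m x.
exists (Num.min d d'); first by rewrite lt_min d0.
move=> y e; rewrite inE ge_min => /orP[/eqP ->|ys] eg ey; first by rewrite Hd' ?orbT.
by rewrite Hd.
Qed.

(** Pigeonhole: each point spoils at most one color, for all levels [m] together. *)
Lemma off_grid_color (s : seq R) k : (size s < k <= q)%N ->
  exists2 c, (c < k)%N & forall x m, x \in s -> ~ on_grid c m x.
Proof.
move=> /andP[sk kq]; apply: contrapT => H.
have /choice[f fP] : forall c : 'I_k, exists i : 'I_(size s), exists m, on_grid c m (tnth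
  (in_tuple s) i).
  move=> c; apply: contrapT => Hc; apply: H; exists c => // x m /(tnthP (in_tuple s))[i ->] g.
  by apply: Hc; exists i, m.
have /leq_card : injective f.
  move=> c c' e; have [m g] := fP c; have [m' g'] := fP c'; rewrite -e in g'.
  by apply/val_inj/(on_grid_inj _ _ g g'); apply: leq_trans (ltn_ord _) kq.
by rewrite !card_ord leqNgt sk.
Qed.

End Grids.

(** * Convex functions with equal kinks *)

Section Kinks.
Variables (R : realType) (rho : R).
Hypothesis rho0 : 0 < rho.
Implicit Types (a : int) (ks : seq R) (c x y : R).

(* [ks] lists the kinks with multiplicity. *)
Definition kinked c a ks : R -> R := bend c (rho * a%:~R) [seq (rho, k) | k <- ks].
(** The right and left slopes of [kinked c a ks] at [x], in units of [rho]. *)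
Definition nr a ks x : int := a + (count (fun k => k <= x) ks)%:Z.
Definition nl a ks x : int := a + (count (fun k => k < x) ks)%:Z.

Lemma sum_count (P : pred R) ks :
  \sum_(w <- [seq (rho, k) | k <- ks] | P w.2) w.1 = rho * (count P ks)%:R.
Proof.
rewrite big_map /=; elim: ks => [|k ks IH]; first by rewrite big_nil mulr0.
by rewrite big_cons /= IH natrD mulrDr; case: (P k); rewrite ?mulr1 ?mulr0 ?add0r.
Qed.

Lemma raff_kinked c a ks x : raff (kinked c a ks) x (rho * (nr a ks x)%:~R).
Proof.
have := raff_bend c (rho * a%:~R) [seq (rho, k) | k <- ks] x.
by rewrite (sum_count (fun k => k <= x)) /nr rmorphD /= mulrDr.
Qed.

Lemma laff_kinked c a ks x : laff (kinked c a ks) x (rho * (nl a ks x)%:~R).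
Proof.
have := laff_bend c (rho * a%:~R) [seq (rho, k) | k <- ks] x.
by rewrite (sum_count (fun k => k < x)) /nl rmorphD /= mulrDr.
Qed.

Lemma kinked_cons c a k ks x :
  kinked c a (k :: ks) x = kinked c a ks x + rho * hinge k x.
Proof. by rewrite /kinked /bend /= big_cons /=; ring. Qed.

Lemma kinked1 c a ks : {in ks, forall k, 1 <= k} -> kinked c a ks 1 = c.
Proof.
move=> h; rewrite /kinked /bend subrr mulr0 addr0 big_map big1_seq ?addr0 // => k /andP[_ kks].
by rewrite hinge_left ?mulr0 // h.
Qed.

Lemma le_nl_nr a ks x : nl a ks x <= nr a ks x.
Proof. by rewrite lerD2l lez_nat sub_count // => k /ltW. Qed.

(** Convexity: a one-sided tangent is a supporting line on both sides of [x], whence no condition on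
    [y]. *)
Lemma kinked_ge_r c a ks x y :
  rho * (nr a ks x)%:~R * (y - x) <= kinked c a ks y - kinked c a ks x.
Proof.
elim: ks => [|k ks IH]; first by rewrite /kinked /bend /nr /= !big_nil addr0; lra.
rewrite !kinked_cons.
have -> : nr a (k :: ks) x = nr a ks x + (k <= x)%R%:Z by rewrite /nr /= PoszD addrCA addrC.
rewrite rmorphD /=.
have h : (k <= x)%R%:~R * (y - x) <= hinge k y - hinge k x.
  case: (leP k x) => kx /=.
    rewrite mul1r (hinge_right kx); case: (leP k y) => ky; first by rewrite hinge_right //; lra.
    by rewrite (hinge_left (ltW ky)); lra.
  by rewrite mul0r (hinge_left (ltW kx)) subr0 hinge_ge0.
have := ler_wpM2l (ltW rho0) h; rewrite -pmulrn; lra.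
Qed.

Lemma kinked_ge_l c a ks x y :
  rho * (nl a ks x)%:~R * (y - x) <= kinked c a ks y - kinked c a ks x.
Proof.
elim: ks => [|k ks IH]; first by rewrite /kinked /bend /nl /= !big_nil addr0; lra.
rewrite !kinked_cons.
have -> : nl a (k :: ks) x = nl a ks x + (k < x)%R%:Z by rewrite /nl /= PoszD addrCA addrC.
rewrite rmorphD /=.
have h : (k < x)%R%:~R * (y - x) <= hinge k y - hinge k x.
  case: (leP x k) => kx /=.
    by rewrite mul0r (hinge_left kx) subr0 hinge_ge0.
  rewrite mul1r (hinge_right (ltW kx)); case: (leP k y) => ky; first by rewrite hinge_right //;
    lra.
  by rewrite (hinge_left (ltW ky)); lra.
have := ler_wpM2l (ltW rho0) h; rewrite -pmulrn; lra.
Qed.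

Lemma kinked_lip c a ks (M : R) x y : `|a%:~R| + (size ks)%:R <= M ->
  `|kinked c a ks y - kinked c a ks x| <= rho * M * `|y - x|.
Proof.
move=> aM; have nM z : `|(nr a ks z)%:~R| <= M.
  apply: le_trans aM; rewrite rmorphD /= (le_trans (ler_normD _ _)) // lerD2l.
  by rewrite -pmulrn normr_nat ler_nat count_size.
have nM' z w : `|rho * (nr a ks z)%:~R * w| <= rho * M * `|w|.
  by rewrite !normrM (gtr0_norm rho0) ler_wpM2r // ler_wpM2l ?(ltW rho0).
have := kinked_ge_r c a ks x y; have := kinked_ge_r c a ks y x.
have := nM' x (y - x); have := nM' y (x - y); rewrite [`|x - y|]distrC.
rewrite !ler_norml; lra.
Qed.

Lemma kinked_affine c a ks e d x :
  {in ks, forall k, d <= `|e - k|} -> e - d <= x <= e + d ->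
  kinked c a ks x = kinked c a ks e + rho * (nl a ks e)%:~R * (x - e).
Proof.
elim: ks => [|k ks IH] kd xd; first by rewrite /kinked /bend /nl /= !big_nil addr0; ring.
rewrite !kinked_cons IH //; last by move=> k' k'ks; apply: kd; rewrite inE k'ks orbT.
have -> : nl a (k :: ks) e = nl a ks e + (k < e)%R%:Z by rewrite /nl /= PoszD addrCA addrC.
have -> : hinge k x = hinge k e + (k < e)%R%:~R * (x - e).
  have := kd k (mem_head _ _); case: (leP e k) => ke /=.
    rewrite ler0_norm ?subr_le0 // => h; rewrite mul0r addr0 !hinge_left //; move: xd; lra.
  rewrite gtr0_norm ?subr_gt0 // => h; rewrite mul1r !hinge_right ?(ltW ke) //; [ring|move: xd;
    lra].
rewrite [X in _ = _ + rho * X * _](rmorphD _ (nl a ks e)) /= -!pmulrn; ring.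
Qed.

(* Slopes are discrete, so uniform closeness forces them to coincide. *)
Lemma kinked_stable c a ks e d eta (n : int) (F : R -> R) :
  0 < d -> 2 * eta <= rho * d ->
  (forall x, e - d <= x <= e + d -> F x = F e + rho * n%:~R * (x - e)) ->
  (forall x, e - d <= x <= e + d -> `|F x - kinked c a ks x| < eta) ->
  nr a ks e = n /\ nl a ks e = n.
Proof.
move=> d0 de FE close.
have h0 : e - d <= e <= e + d by rewrite gerBl lerDl ltW.
have hp : e - d <= e + d <= e + d by rewrite lexx andbT; lra.
have hm : e - d <= e - d <= e + d by rewrite lexx /=; lra.
have := close _ h0; have := close _ hp; have := close _ hm.
have Ep : e + d - e = d by ring.
have Em : e - d - e = - d by ring.
rewrite (FE _ hp) (FE _ hm) !ltr_norml Ep Em => c1 c2 c3.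
have := kinked_ge_r c a ks e (e + d); have := kinked_ge_l c a ks e (e - d).
rewrite Ep Em => kl kr; clear FE close h0 hp hm Ep Em.
have rd : 0 < rho * d by rewrite mulr_gt0.
have lr := le_nl_nr a ks e.
(* Increments over a length [d] differ by less than [2 * eta <= rho * d], that is, by less than one
   unit of slope. *)
have r1 : nr a ks e < n + 1.
  by rewrite -(ltr_int R) [(n + 1)%:~R]rmorphD /= -(ltr_pM2l rd); lra.
have l1 : n - 1 < nl a ks e.
  by rewrite -(ltr_int R) [(n - 1)%:~R]rmorphB /= -(ltr_pM2l rd); lra.
by move: (nr a ks e) (nl a ks e) lr r1 l1; clear => u v; lia.
Qed.

End Kinks.

(** * Cells cut out by a grid *)

Section UpperBound.
Variables (R : realType) (p : nat) (rho B : R) (K : nat) (psi : R -> R).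
Variable X : set (option (R -> R)).
Hypothesis p1 : 1 < p%:R :> R.
Hypothesis rho0 : 0 < rho.
Hypothesis X_kinked : forall f, X (Some f) -> exists a ks,
  [/\ {in ks, forall k, 1 < k < p%:R}, (size ks <= K)%N, `|a%:~R| <= B &
      forall x, 1 <= x <= p%:R -> f x + psi x = kinked rho (f 1) a ks x].

(** Any odd number not below the number [K.+2] of colors would serve. *)
Let q := K.*2.+3.
Let q_odd : odd q. Proof. by rewrite /q /= odd_double. Qed.

Definition straight (F : R -> R) e s := raff F e s /\ laff F e s.

(** One grid serves both for values and for positions: it locates [f 1] between grid points and
    records the slopes at grid points inside the interval. Demanding that neither [f 1] nor a kink
    lies on the grid makes the cells open; [-oo] is a cell by itself. *)
Definition same_cell (c m : nat) (t u : option (R -> R)) : Prop :=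
  match t, u with
  | None, None => True
  | Some f, Some g => forall e, on_grid q c m e ->
      [/\ f 1 <> e, g 1 <> e, (e < f 1) = (e < g 1) & 1 < e < p%:R ->
      exists s, straight (f \+ psi) e s /\ straight (g \+ psi) e s]
  | _, _ => False
  end.

Lemma nr_nl a (ks : seq R) x : nr a ks x = nl a ks x + (count_mem x ks)%:Z.
Proof.
rewrite /nr /nl -addrA -PoszD; congr (_ + Posz _).
elim: ks => //= k ks ->; rewrite le_eqVlt; case: (eqVneq k x) => [->|_] /=.
  by rewrite ltxx !add0n addnCA.
by rewrite add0n addnA.
Qed.

Section Representation.
Variables (f : R -> R) (a : int) (ks : seq R) (e : R).
Hypothesis fE : forall x, 1 <= x <= p%:R -> f x + psi x = kinked rho (f 1) a ks x.
Hypothesis e1p : 1 < e < p%:R.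

Lemma kinked_raff : raff (f \+ psi) e (rho * (nr a ks e)%:~R).
Proof.
apply: (@raff_eq _ _ _ _ _ (p%:R - e)) (raff_kinked rho (f 1) a ks e).
  by rewrite subr_gt0; case/andP: e1p.
by move=> x ex; rewrite -fE //; move: e1p ex; lra.
Qed.

Lemma kinked_laff : laff (f \+ psi) e (rho * (nl a ks e)%:~R).
Proof.
apply: (@laff_eq _ _ _ _ _ (e - 1)) (laff_kinked rho (f 1) a ks e).
  by rewrite subr_gt0; case/andP: e1p.
by move=> x ex; rewrite -fE //; move: e1p ex; lra.
Qed.

Lemma straight_kinked s : straight (f \+ psi) e s ->
  [/\ e \notin ks, nr a ks e = nl a ks e & s = rho * (nl a ks e)%:~R].
Proof.
move=> [sr sl]; have e1 := raff_inj sr kinked_raff; have e2 := laff_inj sl kinked_laff.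
have n12 : nr a ks e = nl a ks e.
  by move: e2; rewrite e1 => /(mulfI (lt0r_neq0 rho0))/eqP; rewrite eqr_int => /eqP.
split => //; apply/count_memPn; move: n12; rewrite nr_nl; lia.
Qed.

Lemma kinked_straight : nr a ks e = nl a ks e ->
  straight (f \+ psi) e (rho * (nl a ks e)%:~R).
Proof. by move=> n12; split; [rewrite -n12; exact: kinked_raff|exact: kinked_laff]. Qed.

End Representation.

Lemma same_cell_sym c m t u : same_cell c m t u -> same_cell c m u t.
Proof.
case: t u => [f|] [g|] //= h e eg; have [h1 h2 h3 h4] := h e eg; split => //.
by move=> /h4[s [s1 s2]]; exists s.
Qed.

Lemma same_cell_trans c m t u v :
  same_cell c m t u -> same_cell c m u v -> same_cell c m t v.
Proof.
case: t u v => [f|] [g|] [h|] //= fg gh e eg.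
have [h1 h2 h3 h4] := fg e eg; have [k1 k2 k3 k4] := gh e eg; split => //; first by rewrite h3.
move=> e1p; have [s [s1 s2]] := h4 e1p; have [r [r1 r2]] := k4 e1p; exists s; split => //.
by rewrite (raff_inj s2.1 r1.1).
Qed.

Lemma same_cell_mono c m n t u : (m <= n)%N -> same_cell c n t u -> same_cell c m t u.
Proof. by move=> mn; case: t u => [f|] [g|] //= h e /(on_grid_mono q_odd mn)/h. Qed.

Lemma same_cell_open c m t u : X t -> X u -> same_cell c m t u ->
  exists e, 0 < e /\ forall v, X v -> dlt p u v e -> same_cell c m t v.
Proof.
case: t u => [f|] [g|] //= Xf Xg fg; last first.
  by exists 1; split => // -[h|].
have [a [ks [ks1p _ _ gE]]] := X_kinked Xg.
(* The end points 1 and [p] are included so that the segment of radius [d] around an inner grid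
   point stays in the domain. *)
have [d d0 Hd] := on_grid_isolated_seq q_odd c m [:: g 1, 1, p%:R & ks].
have rd : 0 < rho * d by rewrite mulr_gt0.
exists (Num.min d (rho * d / 2)); split; first by rewrite lt_min d0 /= divr_gt0.
move=> [h|] // Xh gh e eg; have [h1 h2 h3 h4] := fg e eg.
have [a' [ks' [ks1p' _ _ hE]]] := X_kinked Xh.
have := gh 1; rewrite lexx (ltW p1) lt_min => /(_ isT)/andP[gh1 _].
have eg1 : d <= `|e - g 1| by apply: Hd; rewrite ?mem_head //; apply/eqP/nesym.
have [h5 h6] : h 1 <> e /\ (e < g 1) = (e < h 1).
  move: eg1 gh1; rewrite ltr_norml ler_normr => eg1 gh1.
  by split; [move: eg1 gh1; lra|apply/idP/idP; move: eg1 gh1; lra].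
split => //; first by rewrite h3.
move=> e1p; have [s [sf sg]] := h4 e1p; exists s; split => //.
have [eks n12 sE] := straight_kinked gE e1p sg.
have e_1 : d <= e - 1.
  have := Hd 1 e; rewrite !inE eqxx orbT => /(_ isT eg); rewrite gtr0_norm;
    last by case/andP: e1p => ? _; rewrite subr_gt0.
  by apply; case/andP: e1p => /gt_eqF -> _.
have e_p : d <= p%:R - e.
  have := Hd p%:R e; rewrite !inE eqxx !orbT => /(_ isT eg); rewrite ltr0_norm ?opprB;
    last by case/andP: e1p => _ ?; rewrite subr_lt0.
  by apply; case/andP: e1p => _ /lt_eqF ->.
have kd : {in ks, forall k, d <= `|e - k|}.
  move=> k kks; apply: Hd => //; first by rewrite !inE kks !orbT.
  by apply: contraNneq eks => ->.
have Ie x : e - d <= x <= e + d -> 1 <= x <= p%:R by move: e_1 e_p; lra.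
have [|x xd|x xd|nr' nl'] := @kinked_stable _ _ rho0 (h 1) a' ks' e d (rho * d / 2) (nl a ks e)
  (g \+ psi) d0.
- by lra.
- rewrite /= !gE ?Ie //; last by lra.
  exact: kinked_affine kd xd.
- rewrite /= -hE ?Ie //; have := gh x; rewrite Ie // lt_min => /(_ isT)/andP[_].
  by congr (`|_| < _); ring.
by rewrite sE -nl'; apply: kinked_straight => //; rewrite nr'.
Qed.

Lemma same_cell_refl c m f a ks : {in ks, forall k, 1 < k < p%:R} ->
  (forall x, 1 <= x <= p%:R -> f x + psi x = kinked rho (f 1) a ks x) ->
  (forall x, x \in f 1 :: ks -> ~ on_grid q c m x) ->
  same_cell c m (Some f) (Some f).
Proof.
move=> ks1p fE off e eg; have fe : f 1 <> e.
  by move=> fe; apply: (off e) eg; rewrite -fe mem_head.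
split => // e1p; exists (rho * (nl a ks e)%:~R).
have eks : e \notin ks.
  by apply/negP => eks; apply: (off e) eg; rewrite inE eks orbT.
by split; apply: kinked_straight => //; rewrite nr_nl (count_memPn eks) addr0.
Qed.

(** A Lipschitz bound on each of the roughly [2 ^+ m] grid steps would not tend to 0. As the slopes
    agree at grid points, a step changes the difference by at most [rho * h] times the increase of
    the common slope, and these increases sum to at most [K]. The remaining terms come from the
    values at 1, which no grid point separates, and from the two incomplete steps at the ends. *)
Lemma same_cell_near c m f g : X (Some f) -> X (Some g) ->
  same_cell c m (Some f) (Some g) -> forall x, 1 <= x <= p%:R ->
  `|f x - g x| <= (1 + 4 * (rho * (B + K%:R)) + rho * K%:R) / 2 ^+ m.
Proof.
move=> Xf Xg fg; set h : R := (2 ^+ m)^-1; set M := rho * (B + K%:R).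
have [a [ks [ks1p ksK aB fE]]] := X_kinked Xf.
have [a' [ks' [ks1p' ksK' aB' gE]]] := X_kinked Xg.
have h0 : 0 < h by rewrite invr_gt0 exprn_gt0.
pose D x := kinked rho (f 1) a ks x - kinked rho (g 1) a' ks' x.
suff DM : forall x, 1 <= x <= p%:R -> `|D x| <= (1 + 4 * M + rho * K%:R) * h.
  move=> x x1p; rewrite -(_ : D x = f x - g x); first exact: DM.
  by rewrite /D -fE // -gE //; ring.
have D1 : `|D 1| <= h.
  rewrite /D !kinked1 => [|k /ks1p'/andP[/ltW]|k /ks1p/andP[/ltW]] //.
  have [e eg /andP[e1 e2]] := on_grid_next q_odd c m (f 1).
  have [e' eg' /andP[e1' e2']] := on_grid_next q_odd c m (g 1).
  have [_ _ h1 _] := fg e eg; have [_ _ h2 _] := fg e' eg'.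
  have {}h1 : g 1 <= e by rewrite leNgt -h1 -leNgt ltW.
  have {}h2 : f 1 <= e' by rewrite leNgt h2 -leNgt ltW.
  by rewrite ler_norml /h; lra.
have lip x y : `|D y - D x| <= 2 * M * `|y - x|.
  have bF : `|a%:~R| + (size ks)%:R <= B + K%:R by rewrite lerD // ler_nat.
  have bG : `|a'%:~R| + (size ks')%:R <= B + K%:R by rewrite lerD // ler_nat.
  have := kinked_lip rho0 (f 1) x y bF; have := kinked_lip rho0 (g 1) x y bG.
  by rewrite /D /M !ler_norml; lra.
have [e0 e0g /andP[e01 e0h]] := on_grid_next q_odd c m (1 : R).
rewrite -/h in e0h.
pose e i := e0 + i%:R * h.
have e00 : e 0%N = e0 by rewrite /e mul0r addr0.
have eg i : on_grid q c m (e i).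
  have [j e0E] := e0g; rewrite /e e0E; exists (j + i%:Z).
  by rewrite rmorphD /= mulrDl addrA.
have ei1 i : 1 < e i by rewrite (lt_le_trans e01) // lerDl mulr_ge0 // ltW.
have nlE i : e i < p%:R -> nl a ks (e i) = nl a' ks' (e i).
  move=> eip; have e1p : 1 < e i < p%:R by rewrite ei1.
  have [_ _ _ /(_ e1p)[s [sf sg]]] := fg _ (eg i).
  have [_ _ s1] := straight_kinked fE e1p sf; have [_ _ s2] := straight_kinked gE e1p sg.
  by move: s2; rewrite s1 => /(mulfI (lt0r_neq0 rho0))/eqP; rewrite eqr_int => /eqP.
have claim i : e i < p%:R -> `|D (e i)| <=
    h + 2 * M * h + rho * h * ((nl a ks (e i))%:~R - (nl a ks (e 0%N))%:~R).
  elim: i => [|i IH] eip.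
    rewrite subrr mulr0 addr0; have := lip 1 (e 0%N);
      rewrite e00 [`|e0 - 1|]gtr0_norm ?subr_gt0 //.
    have M0 : 0 <= M by rewrite /M mulr_ge0 ?(ltW rho0) // addr_ge0 // (le_trans _ aB).
    have e0h' : e0 - 1 <= h by rewrite lerBlDl.
    have := ler_wpM2l (mulr_ge0 (ler0n R 2) M0) e0h'.
    by move: D1; rewrite !ler_norml; clear; lra.
  have eE : e i.+1 = e i + h by rewrite /e -natr1; ring.
  have eip' : e i < p%:R by apply: lt_trans eip; rewrite eE ltrDl.
  have {}IH := IH eip'.
  have := kinked_ge_l rho0 (f 1) a ks (e i) (e i.+1).
  have := kinked_ge_l rho0 (f 1) a ks (e i.+1) (e i).
  have := kinked_ge_l rho0 (g 1) a' ks' (e i) (e i.+1).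
  have := kinked_ge_l rho0 (g 1) a' ks' (e i.+1) (e i).
  rewrite -!nlE // (_ : e i.+1 - e i = h) ?eE; last by ring.
  rewrite (_ : e i - (e i + h) = - h); last by ring.
  move: IH; rewrite /D !ler_norml.
  move: (kinked _ _ _ _ _) (kinked _ _ _ _ _) (kinked _ _ _ _ _) (kinked _ _ _ _ _).
  by move=> u1 u2 u3 u4; lra.
have M0 : 0 <= M by rewrite /M mulr_ge0 ?(ltW rho0) // addr_ge0 // (le_trans _ aB).
have Mh : 0 <= M * h by rewrite mulr_ge0 // ltW.
have rK : 0 <= rho * K%:R * h by rewrite !mulr_ge0 ?(ltW rho0) ?(ltW h0).
move=> x x1p; case: (leP x e0) => xe0.
  have : `|x - 1| <= h by rewrite ler_norml; move: x1p; lra.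
  move/(ler_wpM2l (mulr_ge0 (ler0n R 2) M0)); have := lip 1 x.
  by move: D1; rewrite !ler_norml; lra.
have [i ix] : exists i, x <= e i.+1.
  exists (Num.truncn ((x - e0) / h)); rewrite -lerBlDl -ler_pdivrMr // ltW // truncnS_gt //.
case: (ex_minnP (ex_intro (fun i => x <= e i.+1) i ix)) => {ix}{}i ix i_min.
have eix : e i < x.
  case: i ix i_min => [|i] _ i_min; first by rewrite e00.
  by rewrite ltNge; apply/negP => /i_min; rewrite ltnn.
have eip : e i < p%:R by apply: (lt_le_trans eix); case/andP: x1p.
have xe : `|x - e i| <= h.
  by move: ix; rewrite ler_norml /e -natr1 mulrDl mul1r /e => ix; move: eix ix; rewrite /e; lra.
have := ler_wpM2l (mulr_ge0 (ler0n R 2) M0) xe; have := lip (e i) x.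
have nlK : (nl a ks (e i))%:~R - (nl a ks (e 0%N))%:~R <= K%:R :> R.
  rewrite -rmorphB /= /nl opprD addrACA subrr add0r rmorphB /= lerBlDr.
  by rewrite -!pmulrn -natrD ler_nat (leq_trans (count_size _ _)) // (leq_trans ksK) ?leq_addr.
have := ler_wpM2l (ltW (mulr_gt0 rho0 h0)) nlK.
by move: (claim i eip); rewrite !ler_norml; lra.
Qed.

Lemma same_cell_fine t : X t -> exists2 c, (c < K.+2)%N & forall e, 0 < e ->
  exists2 m, same_cell c m t t & forall u, X u -> same_cell c m t u -> dlt p t u e.
Proof.
case: t => [f|] Xf; last first.
  by exists 0%N => // e e0; exists 0%N => // -[g|].
have [a [ks [ks1p ksK aB fE]]] := X_kinked Xf.
have [|c cK off] := off_grid_color q_odd (s := f 1 :: ks) (k := K.+2).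
  by rewrite /= !ltnS ksK /q /=; lia.
exists c => // e e0; set C := 1 + 4 * (rho * (B + K%:R)) + rho * K%:R.
have [m Cm] : exists m, C / 2 ^+ m < e.
  exists (Num.truncn (C / e)).+1; set m := _.+1.
  rewrite ltr_pdivrMr ?exprn_gt0 // mulrC -ltr_pdivrMr //.
  apply: (lt_trans (truncnS_gt _)); rewrite -natrX ltr_nat ltn_expl //.
exists m; first by apply: same_cell_refl ks1p fE _ => x xs; exact: off.
case=> [g|] // Xg fg x x1p; apply: le_lt_trans Cm; exact: (same_cell_near Xf Xg fg).
Qed.

Theorem cover_order_kinked : cover_order_le (dlt p) X K.+2.
Proof.
apply: (@cover_order_colored _ _ _ _ _ same_cell).
- exact: same_cell_sym.
- exact: same_cell_trans.
- exact: same_cell_mono.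
- exact: same_cell_open.
- exact: same_cell_fine.
Qed.

End UpperBound.

(** * Arithmetic of H_p *)

Section HpArithmetic.
Variables (R : realType) (p : nat).
Hypothesis p_pr : prime p.
Local Notation P := (p%:R : R).

Lemma p_gt1 : 1 < P.
Proof. by rewrite ltr1n prime_gt1. Qed.

Lemma p_gt0 : 0 < P.
Proof. exact: lt_trans p_gt1. Qed.

Lemma p_neq0 : P != 0.
Proof. by rewrite gt_eqF // p_gt0. Qed.

Definition level (n : nat) (h : R) : Prop := exists a : int, h = a%:~R / P ^+ n.

Lemma level_inHp n h : level n h -> inHp p h.
Proof. by move=> [a ->]; exists a, n. Qed.

Lemma inHp_level h : inHp p h -> exists n, level n h.
Proof. by move=> [a [n ->]]; exists n, a. Qed.

Lemma level_le m n h : (m <= n)%N -> level m h -> level n h.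
Proof.
move=> mn [a ->]; exists (a * p%:Z ^+ (n - m)).
rewrite rmorphM rmorphXn /= -pmulrn -{2}(subnK mn) exprD.
by field; rewrite ?expf_neq0 ?p_neq0.
Qed.

Lemma level0 n : level n 0. Proof. by exists 0; rewrite mul0r. Qed.

Lemma levelD n h k : level n h -> level n k -> level n (h + k).
Proof. by move=> [a ->] [b ->]; exists (a + b); rewrite rmorphD mulrDl. Qed.

Lemma levelN n h : level n h -> level n (- h).
Proof. by move=> [a ->]; exists (- a); rewrite rmorphN mulNr. Qed.

Lemma level_sum n (I : eqType) (r : seq I) (F : I -> R) :
  (forall i, i \in r -> level n (F i)) -> level n (\sum_(i <- r) F i).
Proof.
elim: r => [|i r IH] h; first by rewrite big_nil; exact: level0.
rewrite big_cons; apply: levelD; first exact/h/mem_head.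
by apply: IH => j jr; apply: h; rewrite inE jr orbT.
Qed.

Lemma levelM m n h k : level m h -> level n k -> level (m + n) (h * k).
Proof.
move=> [a ->] [b ->]; exists (a * b); rewrite rmorphM exprD.
by field; rewrite ?expf_neq0 ?p_neq0.
Qed.

Lemma inHpD (h k : R) : inHp p h -> inHp p k -> inHp p (h + k).
Proof.
move=> /inHp_level[m hm] /inHp_level[n hn]; apply: (@level_inHp (maxn m n)).
by apply: levelD; [apply: level_le hm|apply: level_le hn]; rewrite ?leq_maxl ?leq_maxr.
Qed.

Lemma inHpN (h : R) : inHp p h -> inHp p (- h).
Proof. by move=> /inHp_level[m hm]; apply: (@level_inHp m); exact: levelN. Qed.

Lemma inHpM (h k : R) : inHp p h -> inHp p k -> inHp p (h * k).
Proof.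
by move=> /inHp_level[m hm] /inHp_level[n hn]; apply: (@level_inHp (m + n)); exact: levelM.
Qed.

Lemma inHp_pz (k : int) : inHp p (P ^ k).
Proof.
case: k => k; [exists (p%:Z ^+ k), 0%N|exists 1, k.+1].
  by rewrite rmorphXn /= -pmulrn expr0 divr1.
by rewrite NegzE -exprnN mul1r.
Qed.

Lemma pz_gt0 (k : int) : 0 < P ^ k.
Proof. by rewrite exprz_gt0 // p_gt0. Qed.

Lemma HpSet_scale (k : int) (l : R) : HpSet p (P ^ k * l) = HpSet p l.
Proof.
apply/seteqP; split => [_ [h hp <-]|_ [h hp <-]].
  by exists (P ^ k * h); [exact: inHpM (inHp_pz k) hp|ring].
exists (P ^ (- k) * h); first exact: inHpM (inHp_pz _) hp.
rewrite -exprz_inv; have := pz_gt0 k => /lt0r_neq0 k0.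
by rewrite exprz_inv; rewrite -invr_expz; field.
Qed.

Lemma pz_reduce (l : R) : 0 < l -> exists (k : int) x, 1 <= x < P /\ l = P ^ k * x.
Proof.
move=> l0.
have lt_pX (n : nat) : n%:R < P ^+ n by rewrite -natrX ltr_nat ltn_expl // prime_gt1.
have pX0 n : 0 < P ^+ n by rewrite exprn_gt0 // p_gt0.
pose N := (Num.truncn l^-1).+1.
have lN : 1 <= l * P ^+ N.
  by rewrite -ler_pdivrMl // mulr1 (le_trans (ltW (truncnS_gt _))) // ltW.
have [j jP] : exists j, l * P ^+ N < P ^+ j.+1.
  exists (Num.truncn (l * P ^+ N)); apply: lt_trans (truncnS_gt _) _; exact: lt_pX.
case: (ex_minnP (ex_intro (fun j => l * P ^+ N < P ^+ j.+1) j jP)) => {jP}{}j jP j_min.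
have jP' : P ^+ j <= l * P ^+ N.
  case: j jP j_min => [|j] _ j_min; first by rewrite expr0.
  by rewrite leNgt; apply/negP => /j_min; rewrite ltnn.
exists (j%:Z - N%:Z), (l * P ^+ N / P ^+ j); split.
  rewrite ler_pdivlMr // mul1r jP' /= ltr_pdivrMr // -exprS //.
rewrite expfzDr ?p_neq0 // -exprnN -exprnP.
by field; rewrite !gt_eqF.
Qed.

(** The quotient of [x] by [y] is a positive unit of Z[1/p], hence a power of [p], and it lies
    strictly between 1/p and p. *)
Lemma HpSet_inj (x y : R) : 1 <= x < P -> 1 <= y < P -> HpSet p x = HpSet p y -> x = y.
Proof.
move=> /andP[x1 xp] /andP[y1 yp] xy.
have x0 : 0 < x by apply: lt_le_trans x1.
have y0 : 0 < y by apply: lt_le_trans y1.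
have one : inHp p (1 : R) by exists 1, 0%N; rewrite expr0 divr1.
have [h [a [m hE]] xE] : HpSet p y x by rewrite -xy; exists 1; rewrite ?mulr1.
have [k [b [n kE]] yE] : HpSet p x y by rewrite xy; exists 1; rewrite ?mulr1.
have h0 : 0 < h by move: x0; rewrite -xE pmulr_rgt0.
have k0 : 0 < k by move: y0; rewrite -yE pmulr_rgt0.
have pX0 i : 0 < P ^+ i by rewrite exprn_gt0 // p_gt0.
have hk : h * k = 1.
  by apply: (mulfI (lt0r_neq0 y0)); rewrite mulr1 mulrA xE yE.
have a0 : 0 < a by move: h0; rewrite hE pmulr_lgt0 ?invr_gt0 // ltr0z.
have b0 : 0 < b by move: k0; rewrite kE pmulr_lgt0 ?invr_gt0 // ltr0z.
have abE : a%:~R * b%:~R = P ^+ m * P ^+ n.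
  transitivity (h * k * (P ^+ m * P ^+ n)); last by rewrite hk mul1r.
  by rewrite hE kE; field; rewrite !gt_eqF.
have ab : (`|a| * `|b| = p ^ (m + n))%N.
  apply/eqP; rewrite -abszM -eqz_nat gez0_abs; last by rewrite mulr_ge0 // ltW.
  rewrite -(eqr_int R) rmorphM /= -[(p ^ _)%N%:~R]pmulrn natrX exprD abE //.
have [i _ ai] : exists2 i, (i <= m + n)%N & `|a|%N = (p ^ i)%N.
  by apply/dvdn_pfactor => //; rewrite -ab dvdn_mulr.
have hE' : h * P ^+ m = P ^+ i.
  by rewrite hE divfK ?gt_eqF // -natrX -ai pmulrn gez0_abs // ltW.
have xyE : x * P ^+ m = y * P ^+ i by rewrite -xE -mulrA hE'.
case: (ltngtP i m) => im; last 1 first.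
- by move: xyE; rewrite im => /mulIf; apply; rewrite gt_eqF.
- exfalso; have : x * P ^+ i.+1 <= x * P ^+ m.
    by rewrite ler_pM2l // ler_eXn2l // p_gt1.
  rewrite xyE exprS mulrA ler_pM2r // => h1.
  have : P <= x * P by rewrite ler_peMl // ltW // p_gt0.
  by move=> h2; move: (le_lt_trans (le_trans h2 h1) yp); rewrite ltxx.
exfalso; have : y * P ^+ m.+1 <= y * P ^+ i.
  by rewrite ler_pM2l // ler_eXn2l // p_gt1.
rewrite -xyE exprS mulrA ler_pM2r // => h1.
have : P <= y * P by rewrite ler_peMl // ltW // p_gt0.
by move=> h2; move: (le_lt_trans (le_trans h2 h1) xp); rewrite ltxx.
Qed.

Lemma padic_abs_le (h r : R) (w : int) (a : int) : h = a%:~R * P ^ (- w) ->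
  padic_abs_is p h r -> r <= P ^ w.
Proof.
move=> hE [[_ ->]|[v [u [pu [hE' ->]]]]]; first by rewrite ltW // pz_gt0.
rewrite ler_eXz2l ?p_gt1 //.
rewrite leNgt; apply/negP => wv; case/negP: pu.
have [j jE] : exists j : nat, - v - w = j.+1%:Z.
  by exists (`|- v - w|%N.-1); lia.
have uE : u = a * p%:Z ^+ j.+1.
  apply/eqP; rewrite -(eqr_int R) rmorphM rmorphXn /= -pmulrn; apply/eqP.
  have v0 := lt0r_neq0 (pz_gt0 v).
  apply: (mulfI v0); rewrite -hE' hE [P ^+ j.+1]exprnP -jE !expfzDr ?p_neq0 //.
  by rewrite -(invr_expz _ v); field.
by rewrite uE exprS mulrCA dvdz_mulr.
Qed.

(** As |h|_p is 0 or a power of [p], the strict bound by [P ^+ n.+1] amounts to |h|_p <= p^n. The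
    strict form is what |h|_p <= p^n l gives for [l < p]. *)
Lemma level_padic n (h : R) : inHp p h ->
  (forall r, padic_abs_is p h r -> r < P ^+ n.+1) -> level n h.
Proof.
move=> [a [k hE]] hr; have [a0|a0] := eqVneq a 0.
  by rewrite hE a0 mul0r; exact: level0.
have [m [b [pb aE]]] : exists m (b : int), ~~ (p%:Z %| b)%Z /\ a = p%:Z ^+ m * b.
  have a0' : (0 < `|a|)%N by rewrite absz_gt0.
  have [b cop aE] := pfactor_coprime p_pr a0'.
  have pb : ~~ (p %| b)%N by rewrite -prime_coprime.
  exists (logn p `|a|); case: (lerP 0 a) => sa.
    exists b; split; first by rewrite dvdzE.
    by rewrite -[LHS]gez0_abs // {1}aE PoszM mulrC -rmorphXn.
  exists (- b%:Z); split; first by rewrite dvdzE abszN.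
  by rewrite mulrN -[LHS]opprK -(ltz0_abs sa) {1}aE PoszM mulrC -rmorphXn.
have : padic_abs_is p h (P ^ (- (m%:Z - k%:Z))).
  right; exists (m%:Z - k%:Z), b; split => //; split => //.
  rewrite hE aE rmorphM rmorphXn /= -pmulrn expfzDr ?p_neq0 // -exprnP -exprnN.
  by rewrite -!mulrA [_^-1 * _]mulrC.
move/hr; rewrite -[P ^+ n.+1]/(P ^ n.+1) ltr_eXz2l ?p_gt1 // => kn.
apply: (@level_le (k - m) n); first by lia.
exists (b * p%:Z ^+ (m - k)); rewrite hE aE !rmorphM !rmorphXn /= -pmulrn.
have [km|mk] := leqP k m.
  have -> : (k - m = 0)%N by apply/eqP; rewrite subn_eq0.
  rewrite expr0 divr1 -{1}(subnK km) exprD; field; rewrite expf_neq0 ?p_neq0 //.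
have -> : (m - k = 0)%N by apply/eqP; rewrite subn_eq0 ltnW.
rewrite expr0 mulr1 -{1}(subnK (ltnW mk)) exprD.
by field; rewrite !expf_neq0 ?p_neq0.
Qed.

End HpArithmetic.

(** * Divisors and normal forms *)

Section Degree.
Variables (R : realType) (p : nat).
Hypothesis p_pr : prime p.
Local Notation P := (p%:R : R).

Lemma Cp_HpSet (x : R) : 0 < x -> Cp p (HpSet p x).
Proof. by move=> x0; exists x. Qed.

Lemma Cp_rep H : Cp p H -> exists x : R, 1 <= x < P /\ H = HpSet p x.
Proof.
move=> [l [l0 ->]]; have [k [x [x1 ->]]] := pz_reduce p_pr l0.
by exists x; split => //; rewrite HpSet_scale.
Qed.

(** The class of 1 is kept apart from the other representatives, because its left slope has to be
    read off at the other end [p] of the fundamental interval. *)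
Lemma deg_reps (D : set R -> R) : isDivisor p D -> exists S : seq R,
  [/\ uniq S, {in S, forall x, 1 < x < P},
      forall x, 1 < x < P -> x \notin S -> D (HpSet p x) = 0 &
      deg p D = D (HpSet p 1) + \sum_(x <- S) D (HpSet p x)].
Proof.
move=> [D0 DH Dfin]; set A := [set H | Cp p H /\ D H != 0] in Dfin.
have /choice[rep repP] : forall H, exists x : R, Cp p H -> 1 <= x < P /\ H = HpSet p x.
  by move=> H; case: (pselect (Cp p H)) => [/Cp_rep[x ?]|?]; [exists x|exists 0].
have [s As] : exists s : seq (set R), uniq s /\ A = [set` s].
  have /finite_seqP[s ->] := Dfin; exists (undup s); split; first exact: undup_uniq.
  by apply/seteqP; split => x /=; rewrite mem_undup.
case: As => us As.
have sA H : H \in s -> Cp p H /\ D H != 0 by move=> Hs; have : [set` s] H by []; rewrite -As.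
have S0u : uniq (map rep s).
  rewrite map_inj_in_uniq // => H H' /sA[/repP[_ e] _] /sA[/repP[_ e'] _] ee.
  by rewrite e e' ee.
have S0E x : 1 <= x < P -> D (HpSet p x) != 0 -> x \in map rep s.
  move=> x1 Dx; have Cx : Cp p (HpSet p x).
    by apply: Cp_HpSet; apply: lt_le_trans (proj1 (andP x1)).
  have xs : HpSet p x \in s by have : A (HpSet p x) by []; rewrite As.
  have [r1 r2] := repP _ Cx; apply/mapP; exists (HpSet p x) => //.
  exact: (HpSet_inj p_pr).
have degE : deg p D = \sum_(x <- map rep s) D (HpSet p x).
  rewrite /deg -/A As -fsbig_seq // big_map; apply: eq_big_seq => H /sA[/repP[_ e] _].
  by rewrite -e.
exists (rem 1 (map rep s)); split.
- exact: rem_uniq.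
- move=> x; rewrite mem_rem_uniq // inE => /andP[x1 /mapP[H /sA[/repP[/andP[h1 h2] _] _] xE]].
  by rewrite xE h2 andbT lt_neqAle h1 eq_sym -xE x1.
- move=> x /andP[x1 xp] xS; apply/eqP; apply: contraNT xS => Dx.
  by rewrite mem_rem_uniq // inE gt_eqF //=; apply: S0E; rewrite // (ltW x1) xp.
rewrite degE; case: (boolP (1 \in map rep s)) => h1.
  by rewrite (perm_big _ (perm_to_rem h1)) big_cons.
rewrite rem_id // [D (HpSet p 1)](_ : _ = 0) ?add0r //.
by apply/eqP; apply: contraNT h1; apply: S0E; rewrite lexx p_gt1.
Qed.

End Degree.

(** * Piecewise affine functions as sums of hinges *)

Section PiecewiseBend.
Variables (R : realType) (p : nat).
Hypothesis p_pr : prime p.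
Local Notation P := (p%:R : R).

Lemma inK_bend (f : R -> R) : inK p f -> exists a ws,
  [/\ inHp p a, {in ws, forall w : R * R, 1 < w.2 < P /\ inHp p w.1} &
     forall x, 1 <= x <= P -> f x = bend (f 1) a ws x].
Proof.
move=> [_ _ /(_ 1 P ltr01 (p_gt1 R p_pr))[m [t [t0 [tm tP]]]] _].
have /choice[s sP] : forall i, exists s : R, (i < m)%N -> inHp p s /\
    forall x, t i <= x <= t i.+1 -> f x = f (t i) + s * (x - t i).
  move=> i; case: (ltnP i m) => im; last by exists 0.
  have [ti [c [s [hs fE]]]] := tP i im; exists s => _; split => // x xi.
  by rewrite !fE ?lexx ?(ltW ti) //; ring.
case: m tm tP sP => [|m] tm tP sP.
  by have := p_gt1 R p_pr; rewrite -tm t0 ltxx.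
pose ws j := [seq (s i - s i.-1, t i) | i <- iota 1 j].
have wsS j : ws j.+1 = rcons (ws j) (s j.+1 - s j, t j.+1).
  by rewrite /ws -[in LHS](addn1 j) iotaD map_cat /= add1n cats1.
have bS c a j x : bend c a (ws j.+1) x = bend c a (ws j) x + (s j.+1 - s j) * hinge (t j.+1) x.
  by rewrite /bend wsS -cats1 big_cat big_seq1 /=; ring.
have t_ge i : (i <= m.+1)%N -> 1 <= t i.
  elim: i => [|i IH] im; first by rewrite t0.
  by apply: le_trans (IH (ltnW im)) (ltW (tP i im).1).
have t_lt i : (0 < i)%N -> (i <= m)%N -> 1 < t i < P.
  move=> i0 im; apply/andP; split.
    case: i i0 im => // i _ im; apply: le_lt_trans (tP i (leqW im)).1;
      exact: t_ge (leq_trans (ltnW im) _).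
  have : forall j, (i < j)%N -> (j <= m.+1)%N -> t i < t j.
    elim=> // j IH; rewrite ltnS leq_eqVlt => /orP[/eqP -> h|ij h]; first exact: (tP j h).1.
    exact: lt_trans (IH ij (ltnW h)) (tP j h).1.
  by move/(_ m.+1); rewrite tm; apply.
(* The second half says that the sum of hinges prolongs the piece [j] affinely past its end; the
   next hinge then corrects the slope from [s j] to [s j.+1]. *)
have claim j : (j <= m)%N ->
    (forall x, 1 <= x <= t j.+1 -> f x = bend (f 1) (s 0%N) (ws j) x) /\
    (forall x, t j <= x -> bend (f 1) (s 0%N) (ws j) x = f (t j) + s j * (x - t j)).
  elim: j => [|j IH] jm.
    split=> x; rewrite /bend /ws big_nil addr0 -t0; last by [].
    by move=> xt; rewrite (sP 0%N isT).2.
  have [IH1 IH2] := IH (ltnW jm).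
  have ext x : t j.+1 <= x -> bend (f 1) (s 0%N) (ws j.+1) x = f (t j.+1) + s j.+1 * (x - t j.+1).
    move=> xt; have tj := (tP j (leqW jm)).1;
      rewrite bS IH2 ?(le_trans (ltW tj)) // hinge_right //.
    by rewrite [f (t j.+1)](sP j (leqW jm)).2 ?lexx ?ltW //; ring.
  split=> // x /andP[x1 xt]; case: (leP x (t j.+1)) => xj.
    by rewrite bS hinge_left // mulr0 addr0 IH1 // x1.
  by rewrite ext ?ltW // (sP j.+1 jm).2 // xt ltW.
exists (s 0%N), (ws m); split; first exact: (sP 0%N isT).1.
  move=> w /mapP[i]; rewrite mem_iota add1n => /andP[i0 im] -> /=; split; first exact: t_lt.
  by apply: inHpD => //; [|apply: inHpN => //]; apply: (sP _ _).1 => //; lia.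
by move=> x x1; rewrite (claim m (leqnn m)).1 // tm.
Qed.

End PiecewiseBend.

Section NormalForm.
Variables (R : realType) (p : nat).
Hypothesis p_pr : prime p.
Local Notation P := (p%:R : R).

(** Kinks of [f] and points of the support of [D] may share a position; only the total mass at a
    position has a known sign. *)
Lemma sum_regroup (ws : seq (R * R)) (T : seq R) (F : R -> R) : uniq T ->
  {in ws, forall w, w.2 \in T} ->
  \sum_(k <- T) (\sum_(w <- ws | w.2 == k) w.1) * F k = \sum_(w <- ws) w.1 * F w.2.
Proof.
move=> uT wsT.
transitivity (\sum_(k <- T) \sum_(w <- ws) if w.2 == k then w.1 * F w.2 else 0).
  apply: eq_bigr => k _; rewrite big_distrl /= big_mkcond /=.
  by apply: eq_bigr => w _; case: eqP => // ->.
rewrite exchange_big /=; apply: eq_big_seq => w /wsT wT.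
rewrite (bigD1_seq w.2) //= eqxx big1 ?addr0 // => k kw; rewrite eq_sym (negbTE kw) //.
Qed.

Lemma kinked_flatten (rho c : R) a (T : seq R) (N : R -> nat) :
  bend c (rho * a%:~R) [seq (rho * (N k)%:R, k) | k <- T]
  =1 kinked rho c a (flatten [seq nseq (N k) k | k <- T]).
Proof.
move=> x; rewrite /kinked /bend; congr (_ + _); rewrite !big_map.
elim: T => [|k T IH]; first by rewrite !big_nil.
rewrite big_cons IH /= big_cat /=; congr (_ + _).
elim: (N k) => [|n IHn]; first by rewrite big_nil mulr0 mul0r.
by rewrite big_cons /= -IHn -natr1; ring.
Qed.

(* The left neighbourhood of 1 is the image of that of [p] under [x |-> x / p]. *)
Lemma laff_per (f : R -> R) s : (forall x, 0 < x -> f (P * x) = f x) ->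
  laff f P s -> laff f 1 (P * s).
Proof.
move=> per [d [d0 fE]]; have P0 := p_gt0 R p_pr; have P1 := p_gt1 R p_pr.
exists (Num.min 2^-1 (d / P)); split; first by rewrite lt_min invr_gt0 ltr0n divr_gt0.
move=> x /andP[+ x1]; rewrite lerBlDl -lerBlDr le_min => /andP[x2 xd].
have x0 : 0 < x by lra.
rewrite -per // fE; last first.
  rewrite ger_pMr // x1 andbT; move: xd; rewrite ler_pdivlMr //; lra.
by rewrite -[f 1]per // mulr1; ring.
Qed.

Section Fixed.
Variables (D : set R -> R) (S : seq R) (n : nat).
Hypothesis S_uniq : uniq S.
Hypothesis S_itv : {in S, forall x, 1 < x < P}.
Hypothesis S_supp : forall x, 1 < x < P -> x \notin S -> D (HpSet p x) = 0.
Hypothesis S_deg : deg p D = D (HpSet p 1) + \sum_(x <- S) D (HpSet p x).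
Hypothesis S_level : {in S, forall x, level p n (D (HpSet p x) / x)}.

(** Adding this function to [f] turns D + (f) >= 0 inside the interval into convexity: the total
    mass at [k] becomes the value of D + (f) there divided by [k]. *)
Definition divisor_bend (x : R) := \sum_(k <- S) D (HpSet p k) / k * hinge k x.

Lemma H0_kinked (f : R -> R) : inK p f ->
  (forall l, 0 < l -> 0 <= D (HpSet p l) + Ord f l) -> pnorm_le p f (P ^+ n) ->
  exists a ks, [/\ {in ks, forall k, 1 < k < P}, (size ks)%:R <= P ^+ n * deg p D,
    `|a%:~R| <= P ^+ n * (`|divisor_bend P| + deg p D) &
    forall x, 1 <= x <= P -> f x + divisor_bend x = kinked (P ^- n) (f 1) a ks x].
Proof.
move=> fK fD fn; have [a [ws [aH wsH fE]]] := inK_bend p_pr fK.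
have [_ _ _ per] := fK.
have P0 := p_gt0 R p_pr; have P1 := p_gt1 R p_pr.
have Pn0 : 0 < P ^+ n by rewrite exprn_gt0.
have fr x : 1 <= x < P -> raff f x (a + \sum_(w <- ws | w.2 <= x) w.1).
  move=> /andP[x1 xP]; apply: (@raff_eq _ _ _ _ _ (P - x)) (raff_bend (f 1) a ws x);
    first by rewrite subr_gt0.
  by move=> y xy; rewrite -fE //; move: xy; lra.
have fl x : 1 < x <= P -> laff f x (a + \sum_(w <- ws | w.2 < x) w.1).
  move=> /andP[x1 xP]; apply: (@laff_eq _ _ _ _ _ (x - 1)) (laff_bend (f 1) a ws x);
    first by rewrite subr_gt0.
  by move=> y xy; rewrite -fE //; move: xy; lra.
have inHp_sum (Q : pred (R * R)) : inHp p (a + \sum_(w <- ws | Q w) w.1).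
  apply: inHpD => //; rewrite big_seq_cond; elim/big_ind: _ => [|x y|w /andP[/wsH[]]] //.
  - by exists 0, 0%N; rewrite mul0r.
  - exact: inHpD.
have lev h x : 1 <= x < P -> inHp p h -> h = lslope f x \/ h = rslope f x -> level p n h.
  move=> /andP[x1 xP] hH hx; apply: level_padic => // r hr.
  have x0 : 0 < x by apply: lt_le_trans x1.
  have := fn x x0 h hx r hr; rewrite ler_pdivrMr // => h1.
  by apply: (le_lt_trans h1); rewrite exprSr ltr_pM2l.
have jump x : 1 < x -> \sum_(w <- ws | w.2 <= x) w.1 =
    \sum_(w <- ws | w.2 < x) w.1 + \sum_(w <- ws | w.2 == x) w.1.
  move=> x1; rewrite (bigID (fun w : R * R => w.2 < x)) /=; congr (_ + _); apply: eq_bigl => w.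
    by case: ltgtP.
  by case: ltgtP.
pose dS := [seq (D (HpSet p k) / k, k) | k <- S].
pose T := undup (map snd (ws ++ dS)).
have T_uniq : uniq T by exact: undup_uniq.
have T_in : {in ws ++ dS, forall w, w.2 \in T}.
  by move=> w w_in; rewrite mem_undup map_f.
have T_itv : {in T, forall k, 1 < k < P}.
  move=> k; rewrite mem_undup map_cat mem_cat => /orP[/mapP[w /wsH[w1 _] ->] //|].
  by rewrite -map_comp => /mapP[x xS ->]; exact: S_itv.
pose J k := \sum_(w <- ws ++ dS | w.2 == k) w.1.
have dSE k : 1 < k < P -> \sum_(w <- dS | w.2 == k) w.1 = D (HpSet p k) / k.
  move=> k1; rewrite big_map /=; case: (boolP (k \in S)) => kS.
    by rewrite big_mkcond (bigD1_seq k) //= eqxx big1 ?addr0 // => i ik; rewrite (negbTE ik).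
  rewrite S_supp // mul0r big_seq_cond big1 // => i /andP[iS /eqP ik].
  by rewrite -ik iS in kS.
have JE k : 1 < k < P -> J k = \sum_(w <- ws | w.2 == k) w.1 + D (HpSet p k) / k.
  by move=> k1; rewrite /J big_cat /= dSE.
have J_ge0 k : k \in T -> 0 <= J k.
  move=> /T_itv k1; have /andP[k1' kP] := k1; have k0 : 0 < k by apply: lt_trans k1'.
  have := fD k k0; rewrite /Ord (raff_hplus k0 (fr k _)) ?(ltW k1') //.
  rewrite (laff_hminus k0 (fl k _)) ?k1' ?(ltW kP) // jump // => h.
  rewrite JE // -(pmulr_rge0 _ k0); apply: le_trans h _; rewrite le_eqVlt; apply/orP; left;
    apply/eqP.
  by field; rewrite gt_eqF.
have J_level k : k \in T -> level p n (J k).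
  move=> /T_itv k1; have /andP[k1' kP] := k1; have k0 : 0 < k by apply: lt_trans k1'.
  rewrite JE //; apply: levelD.
    have -> : \sum_(w <- ws | w.2 == k) w.1 =
      (a + \sum_(w <- ws | w.2 <= k) w.1) - (a + \sum_(w <- ws | w.2 < k) w.1).
      by rewrite jump //; ring.
    apply: levelD; last apply: levelN; apply: (lev _ k); rewrite ?(ltW k1') ?kP //.
      by right; rewrite (raff_rslope (fr k _)) // (ltW k1').
    by left; rewrite (laff_lslope (fl k _)) // k1' ltW.
  case: (boolP (k \in S)) => kS; first exact: S_level.
  by rewrite S_supp // mul0r; exact: level0.
have sum1 : \sum_(w <- ws | w.2 <= 1) w.1 = 0.
  rewrite big_seq_cond big1 // => w /andP[/wsH[/andP[w1 _] _]]; rewrite leNgt w1 //.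
have sumP : \sum_(w <- ws | w.2 < P) w.1 = \sum_(w <- ws) w.1.
  by rewrite big_seq_cond [RHS]big_seq; apply: eq_bigl => w; case: (boolP (w \in ws)) =>
    // /wsH[/andP[_ ->]].
have one1 : 1 <= (1 : R) < P by rewrite lexx.
have [a0 aE] : level p n a.
  by apply: (lev _ 1) => //; right; rewrite (raff_rslope (fr 1 one1)) sum1 addr0.
have /choice[Nk NkP] : forall k, exists N : nat, k \in T -> J k = P ^- n * N%:R.
  move=> k; case: (boolP (k \in T)) => kT; last by exists 0%N.
  have [z Jz] := J_level k kT; exists `|z|%N => _.
  have z0 : 0 <= z by move: (J_ge0 k kT); rewrite Jz pmulr_lge0 ?invr_gt0 // ler0z.
  by rewrite Jz -[z in LHS]gez0_abs // mulrC pmulrn.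
have FE x : 1 <= x <= P -> f x + divisor_bend x =
    kinked (P ^- n) (f 1) a0 (flatten [seq nseq (Nk k) k | k <- T]) x.
  move=> x1; rewrite fE // -kinked_flatten /bend aE [P ^- n * _]mulrC -!addrA;
    congr (_ + (_ + _)).
  transitivity (\sum_(w <- ws ++ dS) w.1 * hinge w.2 x).
    by rewrite big_cat big_map.
  rewrite -(sum_regroup (fun k => hinge k x) T_uniq T_in) big_map.
  by apply: eq_big_seq => k kT; rewrite -NkP.
(* By [f P = f 1], the masses of [f] times their positions sum to minus its order at 1. The defect
   in the inequality is thus the value of D + (f) at 1. *)
have ordE : \sum_(k <- T) J k * k <= deg p D.
  rewrite (sum_regroup (fun k => k) T_uniq T_in) big_cat /= S_deg big_map /=.
  have -> : \sum_(k <- S) D (HpSet p k) / k * k = \sum_(k <- S) D (HpSet p k).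
    apply: eq_big_seq => k /S_itv/andP[k1 _]; rewrite divfK // gt_eqF //; exact: lt_trans k1.
  rewrite lerD2r.
  have := fD 1 ltr01; rewrite /Ord (raff_hplus ltr01 (fr 1 one1)) sum1.
  have lP : 1 < P <= P by rewrite P1 lexx.
  rewrite (laff_hminus ltr01 (laff_per per (fl P lP))) sumP !mul1r addr0.
  have : f P = f 1 by rewrite -[in LHS](mulr1 P) per.
  rewrite fE ?lexx ?(ltW P1) // /bend.
  have -> : \sum_(w <- ws) w.1 * hinge w.2 P = P * (\sum_(w <- ws) w.1) - \sum_(w <- ws) w.1 *
    w.2.
    rewrite big_distrr /= -sumrB; apply: eq_big_seq => w /wsH[/andP[_ wP] _].
    by rewrite hinge_right ?(ltW wP) //; ring.
  by move: (\sum_(w <- ws) _) (\sum_(w <- ws) _) (D _) => u v w; lra.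
set ks := flatten _ in FE.
have ks_itv : {in ks, forall k, 1 < k < P}.
  by move=> k /flatten_mapP[k' k'T]; rewrite mem_nseq => /andP[_ /eqP ->]; exact: T_itv.
have size_ks : (size ks)%:R <= P ^+ n * deg p D.
  have -> : (size ks)%:R = \sum_(k <- T) (Nk k)%:R :> R.
    rewrite /ks; elim: (T) => [|k T' IH]; first by rewrite big_nil.
    by rewrite big_cons /= size_cat size_nseq natrD IH.
  apply: (@le_trans _ _ (P ^+ n * \sum_(k <- T) J k * k)); last by rewrite ler_pM2l.
  rewrite big_distrr /= big_seq [leRHS]big_seq; apply: ler_sum => k kT.
  have /andP[k1 _] := T_itv k kT.
  rewrite (NkP k kT) !mulrA mulfV ?gt_eqF // mul1r ler_peMr // ltW //.
exists a0, ks; split => //.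
have degD0 : 0 <= deg p D by rewrite -(pmulr_rge0 _ Pn0); apply: le_trans size_ks.
have P2 : 1 <= P - 1 by rewrite lerBrDr -[1 + 1]/(2%:R) ler_nat prime_gt1.
have P10 : 0 < P - 1 by rewrite subr_gt0.
(* Periodicity determines the initial slope from the kinks, and a bound on their number bounds the
   slope. *)
have := FE P; rewrite (ltW P1) lexx => /(_ isT).
have -> : f P = f 1 by rewrite -[in LHS](mulr1 P) per.
rewrite /kinked /bend big_map /= -big_distrr /=.
set H := \sum_(k <- ks) _ => eqP'.
have H0 : 0 <= H by apply: sumr_ge0 => k _; exact: hinge_ge0.
have HK : H <= P ^+ n * deg p D * (P - 1).
  apply: (@le_trans _ _ ((size ks)%:R * (P - 1))); last by rewrite ler_pM2r.
  rewrite /H; elim: (ks) ks_itv => [|k ks' IH] k1; first by rewrite big_nil mul0r.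
  rewrite big_cons /= -natr1 mulrDl mul1r addrC lerD ?IH //.
    by move=> k' k'in; apply: k1; rewrite inE k'in orbT.
  have /andP[k1' kP] := k1 k (mem_head _ _).
  by rewrite hinge_right ?(ltW kP) // lerD2l lerN2 ltW.
have aE' : a0%:~R * (P - 1) = P ^+ n * divisor_bend P - H.
  apply: (mulfI (invr_neq0 (lt0r_neq0 Pn0))); rewrite [RHS]mulrBr !mulrA mulVf ?gt_eqF // mul1r.
  by move: eqP'; clear; lra.
rewrite -(ler_pM2r P10) -[X in _ * X <= _](gtr0_norm P10) -normrM aE'.
apply: (le_trans (ler_normB _ _)); rewrite [P ^+ n * (_ + _)]mulrDr [leRHS]mulrDl lerD //;
  last by rewrite ger0_norm.
by rewrite normrM (gtr0_norm Pn0) ler_peMr // mulr_ge0 // ltW.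
Qed.

End Fixed.
End NormalForm.

(** * Periodic extension *)

Section PeriodicExtension.
Variables (R : realType) (p : nat).
Hypothesis p_pr : prime p.
Local Notation P := (p%:R : R).

Definition has_partition (f : R -> R) a b := exists (m : nat) (t : nat -> R),
  t 0%N = a /\ t m = b /\ forall i, (i < m)%N -> t i < t i.+1 /\ affine_on p f (t i) (t i.+1).

Lemma has_partition_extend f (a b c : R) : has_partition f a b -> b < c -> affine_on p f b c ->
  has_partition f a c.
Proof.
move=> [m [t [t0 [tm tP]]]] bc fbc.
exists m.+1, (fun i => if (i <= m)%N then t i else c); rewrite leq0n ltnn; split => //;
  split => // i.
move=> im0; have [->|im] /= : i = m \/ (i < m)%N by lia.
  by rewrite leqnn ltnn tm.
by rewrite (ltnW im) im; exact: tP.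
Qed.

(** The supremum of the points reached by finite partitions is itself reached, by affinity on its
    left, and can be passed unless it is [b], by affinity on its right. This avoids an explicit
    partition across several powers of [p]. *)
Lemma has_partition_local f (a b : R) : a < b ->
  (forall x, a <= x < b -> exists s, inHp p s /\ raff f x s) ->
  (forall x, a < x <= b -> exists s, inHp p s /\ laff f x s) ->
  has_partition f a b.
Proof.
move=> ab fr fl; pose A := [set y | a <= y <= b /\ has_partition f a y].
have Aa : A a by split; [rewrite lexx ltW|exists 0%N, (fun=> a)].
have A_ub : ubound A b by move=> y [/andP[]].
have sA : has_sup A by split; [exists a|exists b].
set z := sup A.
have az : a <= z by apply: ub_le_sup Aa; exists b.
have zb : z <= b by apply: ge_sup A_ub; exists a.
have Az : has_partition f a z.
  have [->|za] := eqVneq z a; first by exists 0%N, (fun=> a).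
  have az' : a < z by rewrite lt_neqAle eq_sym za.
  have [|s [hs [d [d0 fE]]]] := fl z; first by rewrite az'.
  have [y Ay zy] := sup_adherent d0 sA.
  have yz : y <= z by apply: ub_le_sup Ay; exists b.
  have [<-|ynz] := eqVneq y z; first by case: Ay.
  apply: has_partition_extend (proj2 Ay) _ _; first by rewrite lt_neqAle ynz.
  exists (f z - s * z), s; split => // x /andP[yx xz].
  by rewrite fE ?xz ?(le_trans (ltW zy)) //; ring.
have [<- //|zb'] := eqVneq z b.
have {}zb' : z < b by rewrite lt_neqAle zb'.
have [|s [hs [d [d0 fE]]]] := fr z; first by rewrite az.
pose y := Num.min b (z + d).
have zy : z < y by rewrite lt_min zb' ltrDl.
suff : y <= z by rewrite leNgt zy.
apply: ub_le_sup; first by exists b.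
split; first by rewrite (le_trans az (ltW zy)) ge_min lexx.
apply: has_partition_extend Az zy _; exists (f z - s * z), s; split => // x /andP[zx xy].
by rewrite fE ?zx /=; [ring|rewrite (le_trans xy) // ge_min lexx orbT].
Qed.

Lemma continuous_raff_laff f (x s t : R) : raff f x s -> laff f x t -> {for x, continuous f}.
Proof.
move=> [d [d0 fr]] [e [e0 fl]]; apply/cvgrPdist_lt => eps eps0.
pose c := `|s| + `|t| + 1; have c0 : 0 < c by rewrite ltr_wpDl // addr_ge0.
near=> y.
have ye : `|x - y| < eps / c by near: y; apply/nbhs_ballP; exists (eps / c) => //=;
  rewrite divr_gt0.
have yd : `|x - y| < d by near: y; apply/nbhs_ballP; exists d.
have ye' : `|x - y| < e by near: y; apply/nbhs_ballP; exists e.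
have main r : `|r| <= c -> f y = f x + r * (y - x) -> `|f x - f y| < eps.
  move=> rc ->; rewrite opprD addrA subrr sub0r normrN normrM distrC.
  by rewrite (le_lt_trans (ler_wpM2r (normr_ge0 _) rc)) // mulrC -ltr_pdivlMr.
case: (leP x y) => xy.
  apply: (main s); first by rewrite /c -addrA lerDl addr_ge0.
  by apply: fr; move: yd; rewrite xy ltr_norml; lra.
apply: (main t); first by rewrite /c addrAC lerDr addr_ge0.
by apply: fl; move: ye'; rewrite (ltW xy) ltr_norml; lra.
Unshelve. all: by end_near. Qed.

Lemma raff_scale (f F : R -> R) (c y d s : R) : 0 < c -> 0 < d ->
  (forall x, y <= x <= y + d -> f (c * x) = F x) -> raff F y s -> raff f (c * y) (s / c).
Proof.
move=> c0 d0 fF [e [e0 FE]]; exists (c * Num.min d e); split;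
  first by rewrite mulr_gt0 // lt_min d0.
move=> x /andP[yx]; rewrite -mulrDr => xy.
have [xc xcE] : exists z, x = c * z by exists (x / c); rewrite mulrC divfK ?gt_eqF.
move: yx xy; rewrite xcE !ler_pM2l // => yx; rewrite -lerBlDl le_min !lerBlDl => /andP[xd xe].
rewrite !fF ?yx ?lexx ?lerDl ?(ltW d0) // FE ?yx //; field; rewrite gt_eqF //.
Qed.

Lemma laff_scale (f F : R -> R) (c y d s : R) : 0 < c -> 0 < d ->
  (forall x, y - d <= x <= y -> f (c * x) = F x) -> laff F y s -> laff f (c * y) (s / c).
Proof.
move=> c0 d0 fF [e [e0 FE]]; exists (c * Num.min d e); split;
  first by rewrite mulr_gt0 // lt_min d0.
move=> x /andP[+ yx]; rewrite -mulrBr => xy.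
have [xc xcE] : exists z, x = c * z by exists (x / c); rewrite mulrC divfK ?gt_eqF.
move: yx xy; rewrite xcE !ler_pM2l // => yx.
rewrite lerBlDl -lerBlDr le_min !lerBlDr -!lerBlDl => /andP[xd xe].
rewrite !fF ?yx ?lexx ?andbT ?gerBl ?(ltW d0) // FE ?yx ?andbT //; field; rewrite gt_eqF //.
Qed.

Lemma mantissa_ex : exists xi : R -> R, forall k (y : R), 1 <= y < P -> xi (P ^ k * y) = y.
Proof.
have /choice[xi xiP] : forall l : R, exists x : R, 0 < l -> 1 <= x < P /\ HpSet p x = HpSet p l.
  move=> l; case: (ltP 0 l) => l0; last by exists 0.
  by have [k [x [x1 ->]]] := pz_reduce p_pr l0; exists x => _; rewrite HpSet_scale.
exists xi => k y y1; have y0 : 0 < y by case/andP: y1 => y1 _; apply: lt_le_trans y1.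
have [h1 h2] := xiP (P ^ k * y) (mulr_gt0 (pz_gt0 R p_pr k) y0).
by apply: (HpSet_inj p_pr) => //; rewrite h2 HpSet_scale.
Qed.

Definition mantissa : R -> R := projT1 (cid mantissa_ex).

Lemma mantissaE k y : 1 <= y < P -> mantissa (P ^ k * y) = y.
Proof. exact: (projT2 (cid mantissa_ex)). Qed.

Definition per_ext (F : R -> R) (x : R) : R := if x <= 0 then 0 else F (mantissa x).

Lemma per_extE F k y : F P = F 1 -> 1 <= y <= P -> per_ext F (P ^ k * y) = F y.
Proof.
move=> F1P; have P1 := p_gt1 R p_pr; have pk0 := pz_gt0 R p_pr k.
have main j (z : R) : 1 <= z < P -> per_ext F (P ^ j * z) = F z.
  move=> z1; rewrite /per_ext mantissaE // leNgt mulr_gt0 ?pz_gt0 //.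
  by case/andP: z1 => z1 _; apply: lt_le_trans z1.
move=> /andP[y1]; rewrite le_eqVlt => /orP[/eqP ->|yP]; last by rewrite main // y1.
rewrite (_ : P ^ k * P = P ^ (k + 1) * 1) ?main ?lexx //.
by rewrite expfzDr ?p_neq0 // mulr1.
Qed.

Section Member.
Variables (n : nat) (D : set R -> R) (a : R) (ws : seq (R * R)).
Let F := bend 0 a ws.
Let f := per_ext F.
Hypothesis a_level : level p n a.
Hypothesis ws_level : {in ws, forall w, 1 < w.2 < P /\ level p n w.1}.
Hypothesis F1P : F P = F 1.
Hypothesis D_bend : forall x, 1 < x < P ->
  0 <= D (HpSet p x) + x * \sum_(w <- ws | w.2 == x) w.1.
(** The left slope at 1 is [p] times the left slope at [p]. *)
Hypothesis D_bend1 : 0 <= D (HpSet p 1) + a - P * (a + \sum_(w <- ws) w.1).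

Let sr x := a + \sum_(w <- ws | w.2 <= x) w.1.
Let sl x := a + \sum_(w <- ws | w.2 < x) w.1.

Lemma level_partial_sum (Q : pred (R * R)) : level p n (a + \sum_(w <- ws | Q w) w.1).
Proof.
apply: levelD => //; rewrite -big_filter; apply: level_sum => w.
by rewrite mem_filter => /andP[_ /ws_level[]].
Qed.

Lemma raff_per_ext k y : 1 <= y < P -> raff f (P ^ k * y) (sr y / P ^ k).
Proof.
move=> /andP[y1 yP]; apply: (@raff_scale f F _ _ (P - y)); rewrite ?pz_gt0 ?subr_gt0 //;
  last exact: raff_bend.
by move=> x xy; apply: per_extE => //; move: xy; lra.
Qed.

Lemma laff_per_ext k y : 1 < y <= P -> laff f (P ^ k * y) (sl y / P ^ k).
Proof.
move=> /andP[y1 yP]; apply: (@laff_scale f F _ _ (y - 1)); rewrite ?pz_gt0 ?subr_gt0 //;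
  last exact: laff_bend.
by move=> x xy; apply: per_extE => //; move: xy; lra.
Qed.

Lemma pz_reduce_left (l : R) : 0 < l -> exists k y, 1 < y <= P /\ l = P ^ k * y.
Proof.
move=> l0; have [k [y [/andP[y1 yP] ->]]] := pz_reduce p_pr l0.
move: y1; rewrite le_eqVlt => /orP[/eqP <-|y1]; last by exists k, y; rewrite y1 ltW.
exists (k - 1), P; rewrite p_gt1 // lexx; split => //.
by rewrite expfzDr ?p_neq0 // -mulrA mulVf ?p_neq0.
Qed.

Lemma inHp_quot k (s : R) : level p n s -> inHp p (s / P ^ k).
Proof. by move=> /level_inHp sH; rewrite invr_expz; apply: inHpM => //; exact: inHp_pz. Qed.

Lemma raff_ex x : 0 < x -> exists s, inHp p s /\ raff f x s.
Proof.
move=> /(pz_reduce p_pr)[k [y [y1 ->]]]; exists (sr y / P ^ k); split; last exact: raff_per_ext.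
exact/inHp_quot/level_partial_sum.
Qed.

Lemma laff_ex x : 0 < x -> exists s, inHp p s /\ laff f x s.
Proof.
move=> /pz_reduce_left[k [y [y1 ->]]]; exists (sl y / P ^ k); split; last exact: laff_per_ext.
exact/inHp_quot/level_partial_sum.
Qed.

Lemma inK_per_ext : inK p f.
Proof.
split.
- by move=> x x0; rewrite /f /per_ext x0.
- move=> x; rewrite in_itv /= andbT => x0; have [s [_ fr]] := raff_ex x0;
    have [t [_ fl]] := laff_ex x0.
  exact: continuous_raff_laff fr fl.
- move=> x y x0 xy; apply: has_partition_local => // z;
    [move=> /andP[xz _]|move=> /andP[/ltW xz _]].
    by apply: raff_ex; apply: lt_le_trans xz.
  by apply: laff_ex; apply: lt_le_trans xz.
move=> x x0; have [k [y [/andP[y1 yP] ->]]] := pz_reduce p_pr x0.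
have y1P : 1 <= y <= P by rewrite y1 ltW.
by rewrite mulrA -{1}[P]expr1z -expfzDr ?p_neq0 // /f !per_extE.
Qed.

(** Replacing [l] by [p l] divides the slope by [p] and so multiplies its p-adic absolute value by
    [p]: the quotient |h|_p / l is invariant. On the fundamental interval it is at most |h|_p <=
    p^n. *)
Lemma pnorm_per_ext : pnorm_le p f (P ^+ n).
Proof.
have key k (y s r : R) : 1 <= y -> level p n s -> padic_abs_is p (s / P ^ k) r ->
    r / (P ^ k * y) <= P ^+ n.
  move=> y1 [b sE] hr; have y0 : 0 < y by apply: lt_le_trans y1.
  have pk0 := pz_gt0 R p_pr k.
  rewrite ler_pdivrMr ?mulr_gt0 //; apply: (@le_trans _ _ (P ^ (n%:Z + k))).
    apply: (padic_abs_le p_pr _ hr (a := b)).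
    by rewrite sE opprD expfzDr ?p_neq0 // -exprnN -invr_expz mulrA.
  rewrite expfzDr ?p_neq0 // -exprnP mulrA ler_peMr //.
  by apply: mulr_ge0; apply: ltW => //; exact: (pz_gt0 R p_pr n).
move=> l l0 h [->|->] r.
  have [k [y [y1 ->]]] := pz_reduce_left l0; rewrite (laff_lslope (laff_per_ext k y1)).
  by apply: key; [case/andP: y1 => /ltW|exact: level_partial_sum].
have [k [y [y1 ->]]] := pz_reduce p_pr l0; rewrite (raff_rslope (raff_per_ext k y1)).
by apply: key; [case/andP: y1|exact: level_partial_sum].
Qed.

Lemma Ord_per_ext l : 0 < l -> 0 <= D (HpSet p l) + Ord f l.
Proof.
move=> l0; have [k [y [y1P lE]]] := pz_reduce p_pr l0.
have pk0 := pz_gt0 R p_pr k; have P0 := p_gt0 R p_pr.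
rewrite lE HpSet_scale // /Ord -lE (@raff_hplus _ _ _ (sr y / P ^ k)) //; last by rewrite lE;
  exact: raff_per_ext.
have /andP[y1 yP] := y1P; move: y1; rewrite le_eqVlt => /orP[/eqP y1|y1].
  have lE' : l = P ^ (k - 1) * P.
    by rewrite lE -y1 expfzDr ?p_neq0 // -mulrA mulVf ?p_neq0.
  rewrite (@laff_hminus _ _ _ (sl P / P ^ (k - 1))) //; last first.
    by rewrite lE'; apply: laff_per_ext; rewrite p_gt1 ?lexx.
  have -> : l * (sr y / P ^ k) = a.
    rewrite lE -y1 mulr1 mulrC divfK ?gt_eqF // /sr big_seq_cond big1 ?addr0 // =>
      w /andP[/ws_level[/andP[w1 _] _]].
    by rewrite leNgt w1.
  have -> : l * (sl P / P ^ (k - 1)) = P * (a + \sum_(w <- ws) w.1).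
    rewrite lE' /sl big_seq_cond [in RHS]big_seq.
    rewrite (eq_bigl (fun w => w \in ws)); last by move=> w; case: (boolP (w \in ws)) =>
      // /ws_level[/andP[_ ->]].
    by field; rewrite gt_eqF // pz_gt0.
  by rewrite -y1 addrA.
rewrite (@laff_hminus _ _ _ (sl y / P ^ k)) //; last first.
  by rewrite lE; apply: laff_per_ext; rewrite y1 ltW.
have -> : l * (sr y / P ^ k) - l * (sl y / P ^ k) = y * \sum_(w <- ws | w.2 == y) w.1.
  rewrite lE /sr /sl (bigID (fun w : R * R => w.2 < y)) /=.
  rewrite (eq_bigl (fun w => w.2 < y)); last by move=> w; case: ltgtP.
  rewrite [X in a + (_ + X)](eq_bigl (fun w => w.2 == y)); last by move=> w; case: ltgtP.
  by field; rewrite gt_eqF.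
by apply: D_bend; rewrite y1.
Qed.

Lemma per_ext_H0 : H0rho p D (P ^+ n) (Some f).
Proof.
right; exists f; split => //; split; first exact: inK_per_ext.
by split; [exact: Ord_per_ext|exact: pnorm_per_ext].
Qed.

End Member.
End PeriodicExtension.

(** * A cube of functions with movable kinks *)

Section CubeOfFunctions.
Variables (R : realType) (p : nat).
Hypothesis p_pr : prime p.
Local Notation P := (p%:R : R).

Lemma hinge_lip (k l x : R) : `|hinge k x - hinge l x| <= `|k - l|.
Proof.
rewrite /hinge; case: (leP (x - k) 0) => h1; case: (leP (x - l) 0) => h2;
  rewrite ler_norml; case: (lerP l k) => h3; lra.
Qed.

Lemma ltn_natr (i j : nat) : (i < j)%N -> i%:R + 2 <= j%:R + 1 :> R.
Proof. by rewrite -(ler_nat R) -natr1; lra. Qed.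

Lemma sum_succ N : \sum_(i < N) i.+1%:R = N%:R * (N%:R + 1) / 2 :> R.
Proof.
elim: N => [|N IH]; first by rewrite big_ord0 mul0r mul0r.
by rewrite big_ord_recr /= IH -natr1; field.
Qed.

Variables (D : set R -> R) (S : seq R) (n N : nat).
Hypothesis S_uniq : uniq S.
Hypothesis S_itv : {in S, forall x, 1 < x < P}.
Hypothesis S_supp : forall x, 1 < x < P -> x \notin S -> D (HpSet p x) = 0.
Hypothesis S_deg : deg p D = D (HpSet p 1) + \sum_(x <- S) D (HpSet p x).
Hypothesis S_level : {in S, forall x, level p n (D (HpSet p x) / x)}.
Let rho := P ^- n.
Let M := N.+1%:R : R.
Variable a : R.
Hypothesis a_level : level p n a.
Let sumS := \sum_(k <- S) D (HpSet p k) / k.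
(** D + (f) is to vanish at 1, so that the whole degree is available to the movable kinks. *)
Hypothesis aE : a - P * (a + rho * M - sumS) = - D (HpSet p 1).
(* The excess to be shared among the kinks, which would otherwise all sit at 1. *)
Let tau := P ^+ n * deg p D - M.
Hypothesis tau_gt0 : 0 < tau.
Hypothesis tau_le : tau <= P.
Hypothesis M_ge : 2 * P <= M.

(** At the base point the kinks sit at 1 + g, 1 + 2g, ..., 1 + Mg, and [g] makes their excesses over
    1 add up to [tau]. The amplitude [r] is so small that even the last kink, which absorbs all the
    displacements, moves by at most g/8. *)
Let W := \sum_(i < N) i.+1%:R + M.
Let g := tau / W.
Let r := g / (8 * M).

Definition kink (v : 'rV[R]_N) (i : 'I_N) : R := 1 + g * i.+1%:R + r * v ord0 i.
(* The last kink keeps the sum of all kinks, hence the degree, constant. *)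
Definition last_kink (v : 'rV[R]_N) : R := 1 + g * M - r * \sum_i v ord0 i.
Definition cube_kinks (v : 'rV[R]_N) : seq R := rcons [seq kink v i | i <- enum 'I_N] (last_kink
  v).
(** The kinks over [S] cancel [D] there, so that inside the interval D + (f) comes from the movable
    kinks alone. *)
Definition cube_ws (v : 'rV[R]_N) : seq (R * R) :=
  [seq (- (D (HpSet p k) / k), k) | k <- S] ++ [seq (rho, k) | k <- cube_kinks v].
Definition cube_fun v : R -> R := bend 0 a (cube_ws v).

Let P0 : 0 < P := p_gt0 R p_pr.
Let P1 : 1 < P := p_gt1 R p_pr.
Let M0 : 0 < M. Proof. by rewrite /M ltr0n. Qed.
Let Pn0 : 0 < P ^+ n. Proof. by rewrite exprn_gt0. Qed.
Let rho0 : 0 < rho. Proof. by rewrite /rho invr_gt0. Qed.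
Let WE : W = M * (M + 1) / 2.
Proof. by rewrite /W sum_succ /M -natr1; field. Qed.
Let W0 : 0 < W. Proof. by rewrite WE !mulr_gt0 ?invr_gt0 ?addr_gt0. Qed.
Let g0 : 0 < g. Proof. by rewrite divr_gt0. Qed.
Let r0 : 0 < r. Proof. by rewrite divr_gt0 // mulr_gt0. Qed.
(** The product is 2 tau / (M + 1), and [tau <= P] and [2 * P <= M]. Hence all kinks lie between 1
    and 2. *)
Let gM : g * M < 1.
Proof.
rewrite /g mulrAC ltr_pdivrMr // mul1r WE -mulrA mulrC ltr_pM2l //.
rewrite ltr_pdivlMr //; have := tau_le; have := M_ge; lra.
Qed.
Let rM : r * M = g / 8.
Proof. by rewrite /r; field; rewrite gt_eqF. Qed.

Lemma cube_sum_bound (v : 'rV[R]_N) : cube v -> 0 <= r * \sum_i v ord0 i <= g / 8.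
Proof.
move=> cv; rewrite mulr_ge0 ?(ltW r0) ?sumr_ge0 //=; last by move=> i _; case/andP: (cv i).
rewrite -rM ler_pM2l //; apply: (@le_trans _ _ (\sum_(i < N) 1)).
  by apply: ler_sum => i _; case/andP: (cv i).
by rewrite sumr_const card_ord /M ler_nat.
Qed.

Lemma cube_coord_bound (v : 'rV[R]_N) i : cube v -> 0 <= r * v ord0 i <= g / 8.
Proof.
move=> cv; have /andP[v0 v1] := cv i; rewrite mulr_ge0 ?(ltW r0) //= -rM ler_pM2l //.
by rewrite (le_trans v1) // /M ler1n.
Qed.

Lemma cube_kinks_itv v : cube v -> {in cube_kinks v, forall k, 1 < k < P}.
Proof.
move=> cv k; rewrite mem_rcons inE => /orP[/eqP ->|/mapP[i _ ->]].
  rewrite /last_kink; have := cube_sum_bound cv; have := gM; have := P1; have := g0.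
  have : 2 <= P by rewrite ler_nat prime_gt1.
  have : g <= g * M by rewrite ler_peMr // ?(ltW g0) // /M ler1n.
  by move: (r * _) (g * M) => u w; lra.
rewrite /kink; have := cube_coord_bound i cv; have := gM; have := g0.
have : 2 <= P by rewrite ler_nat prime_gt1.
have : g * (i.+1%:R + 1) <= g * M.
  by rewrite ler_pM2l // /M natr1 ler_nat ltnS.
have : 0 < g * i.+1%:R by rewrite mulr_gt0.
by move: (r * _) (g * M) => u w; lra.
Qed.

Lemma sum_cube_kinks v (G : R -> R) :
  \sum_(k <- cube_kinks v) G k = \sum_i G (kink v i) + G (last_kink v).
Proof. by rewrite /cube_kinks -cats1 big_cat big_seq1 big_map big_enum. Qed.

Lemma cube_funE v x : cube_fun v x = a * (x - 1) - \sum_(k <- S) D (HpSet p k) / k * hinge k x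
  + rho * (\sum_i hinge (kink v i) x + hinge (last_kink v) x).
Proof.
rewrite /cube_fun /bend add0r -addrA; congr (_ + _).
rewrite /cube_ws big_cat !big_map -big_distrr /= sum_cube_kinks; congr (_ + _).
by rewrite -sumrN; apply: eq_bigr => k _; rewrite mulNr.
Qed.

Lemma sum_cube_ws v : \sum_(w <- cube_ws v) w.1 = rho * M - sumS.
Proof.
rewrite /cube_ws big_cat !big_map /= sumrN -(mulr1 rho) -big_distrr /= sum_cube_kinks.
rewrite sumr_const card_ord natr1 addrC mulr1 //.
Qed.

Lemma cube_fun1 v : cube v -> cube_fun v 1 = 0.
Proof.
move=> cv; have ki := cube_kinks_itv cv.
rewrite cube_funE subrr mulr0 sub0r big_seq big1 ?oppr0 ?add0r => [|k /S_itv/andP[k1 _]];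
  last first.
  by rewrite hinge_left ?mulr0 // ltW.
rewrite hinge_left; last by apply/ltW/(proj1 (andP (ki _ _))); rewrite mem_rcons mem_head.
rewrite addr0 big1 ?mulr0 // => i _; rewrite hinge_left //; apply/ltW/(proj1 (andP (ki _ _))).
by rewrite mem_rcons inE map_f ?orbT // mem_enum.
Qed.

(** The kinks add up to [tau + M], which is [P ^+ n * deg p D]; given [aE], this is the vanishing of
    the degree of a principal divisor. *)
Lemma cube_fun_per v : cube v -> cube_fun v P = cube_fun v 1.
Proof.
move=> cv; have ki := cube_kinks_itv cv; rewrite cube_fun1 // cube_funE.
have -> : \sum_(k <- S) D (HpSet p k) / k * hinge k P = P * sumS - \sum_(k <- S) D (HpSet p k).
  rewrite /sumS big_distrr /= -sumrB; apply: eq_big_seq => k /S_itv/andP[k1 kP].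
  rewrite hinge_right ?(ltW kP) //; field; rewrite gt_eqF //; exact: lt_trans k1.
have -> : \sum_i hinge (kink v i) P + hinge (last_kink v) P = M * P - (tau + M).
  rewrite -(sum_cube_kinks v (fun k => hinge k P)).
  have -> : \sum_(k <- cube_kinks v) hinge k P = \sum_(k <- cube_kinks v) (P - k).
    by apply: eq_big_seq => k /ki/andP[_ kP]; rewrite hinge_right // ltW.
  rewrite sum_cube_kinks sumrB sumr_const card_ord /kink /last_kink !big_split /= -!big_distrr /=.
  have -> : tau = g * (\sum_(i < N) i.+1%:R + M) by rewrite /g -/W divfK // gt_eqF.
  by rewrite sumr_const card_ord /M -natr1; ring.
have -> : tau + M = P ^+ n * deg p D by rewrite /tau subrK.
have -> : rho * (M * P - P ^+ n * deg p D) = rho * M * P - deg p D.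
  by rewrite /rho; field; rewrite gt_eqF.
by rewrite S_deg; move: aE; lra.
Qed.

Lemma cube_fun_H0 v : cube v -> H0rho p D (P ^+ n) (Some (per_ext p_pr (cube_fun v))).
Proof.
move=> cv; have ki := cube_kinks_itv cv; apply: per_ext_H0 => //.
- move=> w; rewrite mem_cat => /orP[/mapP[k kS ->]|/mapP[k kk ->]] /=.
    by split; [exact: S_itv|apply/levelN/S_level].
  by split; [exact: ki|exists 1; rewrite mul1r].
- exact: cube_fun_per.
- move=> x x1; rewrite /cube_ws big_cat big_map /=.
  set A := \sum_(j <- _ | _) _; set B := \sum_(j <- _ | _) _.
  have B0 : 0 <= B by rewrite /B big_map; apply: sumr_ge0 => k _; exact: ltW.
  have x0 : 0 < x by case/andP: x1 => x1 _; apply: lt_trans x1.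
  have -> : A = - (D (HpSet p x) / x).
    rewrite /A; case: (boolP (x \in S)) => xS.
      by rewrite big_mkcond (bigD1_seq x) //= eqxx big1 ?addr0 // => i ix; rewrite (negbTE ix).
    rewrite (S_supp x1 xS) mul0r oppr0 big_seq_cond big1 // => i /andP[iS /eqP ix].
    by rewrite -ix iS in xS.
  rewrite mulrDr mulrN [x * (_ / x)]mulrC divfK; last by rewrite gt_eqF.
  by rewrite addrA subrr add0r mulr_ge0 // ltW.
- by rewrite sum_cube_ws; move: aE; lra.
Qed.

(* For [i < N] the kink [i] is the only one that moves between [sep i] and
   [sep i.+1], so that the increment of [f] there determines its position. *)
Let sep (i : nat) : R := 1 + g * i.+1%:R - g / 2.

(** Moving the kink [i] to the right by [r * v] lowers the increment by [rho * r * v] compared with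
    the base point. Any value would do at [-oo], an isolated point. *)
Definition cube_coord (i : 'I_N) (t : option (R -> R)) : R :=
  if t is Some f then
    (cube_fun 0 (sep i.+1) - cube_fun 0 (sep i) - (f (sep i.+1) - f (sep i))) / (rho * r)
  else 0.

Lemma cube0 : cube (0 : 'rV[R]_N).
Proof. by move=> i; rewrite mxE lexx ler01. Qed.

Lemma sep_itv (i : nat) : (i <= N)%N -> 1 <= sep i <= P.
Proof.
move=> iN; rewrite /sep; have := gM; have := g0; have := P1.
have : g * i.+1%:R <= g * M by rewrite ler_pM2l // /M ler_nat.
have : g <= g * i.+1%:R by rewrite ler_peMr // ?(ltW g0) // ler1n.
have : 2 <= P by rewrite ler_nat prime_gt1.
by move: (g * _) (g * M) => u w; lra.
Qed.

Lemma per_ext_cube_fun v x : cube v -> 1 <= x <= P -> per_ext p_pr (cube_fun v) x = cube_fun v x.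
Proof.
by move=> cv x1; have := per_extE p_pr 0 (cube_fun_per cv) x1; rewrite expr0z mul1r.
Qed.

Lemma cube_coordE v i : cube v -> cube_coord i (Some (per_ext p_pr (cube_fun v))) = v ord0 i.
Proof.
move=> cv; rewrite /cube_coord !per_ext_cube_fun ?sep_itv // ?ltnS; last first.
  by rewrite ltnW.
(* The interval has length [g] and contains only the kink [i], near its middle: hinges to the left
   rise by [g], those to the right by 0. *)
have hE (w : 'rV[R]_N) (j : 'I_N) : cube w ->
    hinge (kink w j) (sep i.+1) - hinge (kink w j) (sep i) =
    (if (j < i)%N then g else if j == i then g / 2 - r * w ord0 j else 0).
  move=> cw; have := cube_coord_bound j cw => /andP[b1 b2].
  have gg := g0; have natS (m : nat) : m.+1%:R = m%:R + 1 :> R by rewrite natr1.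
  have natSS (m : nat) : m.+2%:R = m%:R + 2 :> R by rewrite -addn2 natrD.
  rewrite /kink /sep (natSS i) (natS i) (natS j).
  case: ltngtP => ji.
  - have h : g * (j%:R + 2) <= g * (i%:R + 1) by rewrite (ler_pM2l gg); exact: ltn_natr.
    have h2 : 1 + g * (j%:R + 1) + r * w ord0 j <= 1 + g * (i%:R + 1) - g / 2.
      by move: h b1 b2 gg; lra.
    have h3 : 1 + g * (j%:R + 1) + r * w ord0 j <= 1 + g * (i%:R + 2) - g / 2.
      by move: h2 gg; lra.
    by rewrite (hinge_right h2) (hinge_right h3); ring.
  - have h : g * (i%:R + 2) <= g * (j%:R + 1) by rewrite (ler_pM2l gg); exact: ltn_natr.
    have h2 : 1 + g * (i%:R + 2) - g / 2 <= 1 + g * (j%:R + 1) + r * w ord0 j.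
      by move: h b1 b2 gg; lra.
    have h3 : 1 + g * (i%:R + 1) - g / 2 <= 1 + g * (j%:R + 1) + r * w ord0 j.
      by move: h2 gg; lra.
    by rewrite -val_eqE (gtn_eqF ji) (hinge_left h2) (hinge_left h3) subrr.
  have h2 : 1 + g * (j%:R + 1) + r * w ord0 j <= 1 + g * (i%:R + 2) - g / 2.
    by rewrite ji; move: b1 b2 gg; lra.
  have h3 : 1 + g * (i%:R + 1) - g / 2 <= 1 + g * (j%:R + 1) + r * w ord0 j.
    by rewrite ji; move: b1 b2 gg; lra.
  by rewrite (hinge_right h2) (hinge_left h3) -val_eqE /= ji eqxx; field.
pose E (w : 'rV[R]_N) (j : 'I_N) := if (j < i)%N then g else if j == i then g / 2 - r * w ord0 j
  else 0.
pose C := a * (sep i.+1 - sep i) - \sum_(k <- S) D (HpSet p k) / k * hinge k (sep i.+1)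
  + \sum_(k <- S) D (HpSet p k) / k * hinge k (sep i).
have Fd w : cube w -> cube_fun w (sep i.+1) - cube_fun w (sep i) = C + rho * \sum_j E w j.
  move=> cw; have -> : \sum_j E w j =
      \sum_j hinge (kink w j) (sep i.+1) - \sum_j hinge (kink w j) (sep i).
    by rewrite -sumrB; apply: eq_bigr => j _; rewrite hE.
  have := cube_sum_bound cw => /andP[b1 b2].
  have h : g * (i.+1%:R + 1) <= g * M by rewrite ler_pM2l // /M natr1 ler_nat ltnS.
  rewrite !cube_funE !(@hinge_left _ (last_kink w)) /C; first by ring.
    by rewrite /sep /last_kink; move: h b1 b2 g0; move: (r * _) (g * M) => u w'; lra.
  by rewrite /sep /last_kink -natr1; move: h b1 b2 g0; move: (r * _) (g * M) => u w'; lra.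
have EE : \sum_j E 0 j = \sum_j E v j + r * v ord0 i.
  apply/eqP; rewrite -subr_eq0 opprD addrA -sumrB (bigD1 i) //= big1 ?addr0 => [|j ji].
    by rewrite /E ltnn eqxx mxE mulr0 subr0; apply/eqP; ring.
  by rewrite /E; case: ltnP => // _; rewrite ?(negbTE ji) subrr.
rewrite (Fd _ cv) (Fd _ cube0) EE; field.
by rewrite !gt_eqF.
Qed.

Theorem H0_cover_order_ge k : cover_order_le (dlt p) (H0rho p D (P ^+ n)) k -> (N < k)%N.
Proof.
apply: (@cover_order_ge_cube R _ _ _ N (fun v => Some (per_ext p_pr (cube_fun v))) cube_coord).
- exact: cube_fun_H0.
(* The factor 2 is there because each coordinate moves its own kink and the last one; adding 1 keeps
   [c] positive. *)
- move=> v cv e e0; pose c := 2 * rho * r * N%:R + 1.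
  have rr0 : 0 <= rho * r by apply/ltW/mulr_gt0.
  have rN0 : 0 <= rho * r * N%:R by apply: mulr_ge0.
  have c0 : 0 < c by rewrite /c; lra.
  exists (e / c); split; first by rewrite divr_gt0.
  move=> w cw vw x x1; rewrite !per_ext_cube_fun // !cube_funE.
  pose V := \sum_i `|v ord0 i - w ord0 i|.
  have VN : V <= N%:R * (e / c).
    rewrite mulr_natl -[X in _ *+ X]card_ord -sumr_const; apply: ler_sum => i _; exact: ltW.
  rewrite opprD addrACA subrr add0r -mulrBr opprD addrACA -sumrB normrM (gtr0_norm rho0).
  have h1 : `|\sum_i (hinge (kink v i) x - hinge (kink w i) x)| <= r * V.
    apply: (le_trans (ler_norm_sum _ _ _)); rewrite /V big_distrr /=; apply: ler_sum => i _.
    apply: (le_trans (hinge_lip _ _ _)); rewrite /kink opprD addrACA subrr add0r -mulrBr.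
    by rewrite normrM (gtr0_norm r0).
  have h2 : `|hinge (last_kink v) x - hinge (last_kink w) x| <= r * V.
    apply: (le_trans (hinge_lip _ _ _));
      rewrite /last_kink opprD addrACA subrr add0r -opprD normrN.
    rewrite -mulrBr normrM (gtr0_norm r0) ler_pM2l // -sumrB; exact: ler_norm_sum.
  have h3 := le_trans (ler_normD _ _) (lerD h1 h2).
  apply: (le_lt_trans (ler_wpM2l (ltW rho0) h3)).
  have rr : 0 <= rho * (r + r) by rewrite mulr_ge0 ?addr_ge0 // ltW.
  rewrite -mulrDl mulrA; apply: (le_lt_trans (ler_wpM2l rr VN)).
  by rewrite !mulrA ltr_pdivrMr // mulrC ltr_pM2l // /c; lra.
- move=> [f|] Xf e e0; last by exists 1; split => // -[|] // _ _ i; rewrite /= subrr normr0.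
  exists (e * (rho * r) / 2); split; first by rewrite divr_gt0 // mulr_gt0 // mulr_gt0.
  move=> [h|] // Xh fh i; have rr : 0 < rho * r by rewrite mulr_gt0.
  rewrite /cube_coord -mulrBl normrM normfV (gtr0_norm rr) ltr_pdivrMr //.
  have := fh _ (sep_itv (ltnW (ltn_ord i))); have := fh _ (sep_itv (ltn_ord i)).
  by rewrite !ltr_norml; lra.
- by move=> v i cv; exact: cube_coordE.
Qed.

End CubeOfFunctions.

(** * The limit *)

Section Dimension.
Variables (R : realType) (p : nat).
Hypothesis p_pr : prime p.
Local Notation P := (p%:R : R).

Lemma level_seq (S : seq R) (F : R -> R) : {in S, forall x, inHp p (F x)} ->
  exists m, forall n, (m <= n)%N -> {in S, forall x, level p n (F x)}.
Proof.
elim: S => [|x S IH] h; first by exists 0%N.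
have [|m Hm] := IH; first by move=> y yS; apply: h; rewrite inE yS orbT.
have [k xk] := inHp_level (h x (mem_head _ _)).
exists (maxn m k) => n; rewrite geq_max => /andP[mn kn] y.
by rewrite inE => /orP[/eqP ->|/Hm]; [exact: level_le xk|apply].
Qed.

Lemma divisor_inHp (D : set R -> R) x : isDivisor p D -> 0 < x -> inHp p (D (HpSet p x) / x).
Proof.
move=> [_ DH _] x0; have [h hH <-] := DH _ (Cp_HpSet p x0).
by rewrite mulrC mulKf // gt_eqF.
Qed.

Lemma covdim_le (X : set (option (R -> R))) k : cover_order_le (dlt p) X k ->
  (covdim (dlt p) X <= (k%:R - 1)%:E)%E.
Proof. by move=> Xk; apply: ereal_inf_lbound; exists k. Qed.

Lemma covdim_ge (X : set (option (R -> R))) k :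
  (forall j, cover_order_le (dlt p) X j -> (k < j)%N) -> (k%:R%:E <= covdim (dlt p) X)%E.
Proof.
move=> Xk; apply: le_ereal_inf_tmp => _ [j /Xk kj <-].
by rewrite lee_fin lerBrDr natr1 ler_nat.
Qed.

(** The space contains [-oo], and a cover of a nonempty space cannot have order 0. This is the lower
    bound when the degree is not positive. *)
Lemma covdim_ge0 (D : set R -> R) r : (0 <= covdim (dlt p) (H0rho p D r))%E.
Proof.
apply: (@covdim_ge _ 0) => k Hk; rewrite lt0n; apply/negP => /eqP k0; move: Hk; rewrite k0.
move=> /(_ [set H0rho p D r])[|C' [[C'o C'c] [_ C'k]]].
  split=> [_ ->|x Xx]; last by exists (H0rho p D r).
  by split=> // x Xx; exists 1; split.
have X0 : H0rho p D r None by left.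
have [V [CV V0]] := C'c _ X0.
have [//|i [j [/andP[ij j1] _]]] := C'k _ X0 (fun=> V).
by move: ij j1; case: j.
Qed.

Lemma covdim_H0_le (D : set R -> R) : isDivisor p D -> exists m, forall n, (m <= n)%N ->
  (covdim (dlt p) (H0rho p D (P ^+ n)) <= (P ^+ n * Num.max (deg p D) 0 + 1)%:E)%E.
Proof.
move=> Ddiv; have [S [S_uniq S_itv S_supp S_deg]] := deg_reps p_pr Ddiv.
have [|m Hm] := @level_seq S (fun x => D (HpSet p x) / x).
  by move=> x /S_itv/andP[x1 _]; apply: divisor_inHp => //; exact: lt_trans x1.
exists m => n /Hm S_level; have Pn0 : 0 < P ^+ n by rewrite exprn_gt0 // p_gt0.
set K := Num.truncn (P ^+ n * Num.max (deg p D) 0).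
have d0 : 0 <= P ^+ n * Num.max (deg p D) 0.
  by rewrite mulr_ge0 ?(ltW Pn0) // le_max lexx orbT.
have ub : cover_order_le (dlt p) (H0rho p D (P ^+ n)) K.+2.
  apply: (@cover_order_kinked R p (P ^- n) (P ^+ n * (`|divisor_bend p D S P| + deg p D)) K
    (divisor_bend p D S)); rewrite ?p_gt1 ?invr_gt0 //.
  move=> f [//|[_ [[<-] [fK [fD fn]]]]].
  have [a [ks [k1 k2 k3 k4]]] := H0_kinked p_pr S_uniq S_itv S_supp S_deg S_level fK fD fn.
  exists a, ks; split => //; rewrite /K truncn_ge_nat //.
  by apply: (le_trans k2); rewrite ler_pM2l // le_max lexx.
apply: (le_trans (covdim_le ub)); rewrite lee_fin -natr1 addrK -natr1 lerD2r.
by rewrite /K truncn_le.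
Qed.

(** In units of [p^-n], the condition on the order at 1 has an integral initial slope exactly when
    [N.+1] is congruent to [z1 + zS] modulo [p - 1]. The largest such number among those below [q]
    is taken. *)
Lemma covdim_H0_ge (D : set R -> R) : isDivisor p D -> 0 < deg p D ->
  exists m, forall n, (m <= n)%N ->
  ((P ^+ n * deg p D - (P + 1))%:E <= covdim (dlt p) (H0rho p D (P ^+ n)))%E.
Proof.
move=> Ddiv d0; have [S [S_uniq S_itv S_supp S_deg]] := deg_reps p_pr Ddiv.
have P0 := p_gt0 R p_pr; have P1 := p_gt1 R p_pr.
have [|m Hm] := @level_seq (1 :: S) (fun x => D (HpSet p x) / x).
  move=> x; rewrite inE => /orP[/eqP ->|/S_itv/andP[x1 _]]; apply: divisor_inHp => //.
  exact: lt_trans x1.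
(* For these [n] one has [q > 3 * P]; since more than [q - P] kinks are used, there are at least
   [2 * P] of them. *)
exists (maxn m (Num.truncn (3 * P / deg p D)).+1) => n; rewrite geq_max =>
  /andP[/Hm S_level1 nlarge].
have S_level : {in S, forall x, level p n (D (HpSet p x) / x)}.
  by move=> x xS; apply: S_level1; rewrite inE xS orbT.
have Pn0 : 0 < P ^+ n by rewrite exprn_gt0.
set q := P ^+ n * deg p D.
have q_large : 3 * P < q.
  rewrite /q -ltr_pdivrMr //; apply: (lt_trans (truncnS_gt _)).
  apply: (@le_lt_trans _ _ n%:R); first by rewrite ler_nat.
  by rewrite -natrX ltr_nat ltn_expl // prime_gt1.
have [z1 z1E] : level p n (D (HpSet p 1)).
  by have := S_level1 1 (mem_head _ _); rewrite divr1.
have [zS zSE] : level p n (\sum_(k <- S) D (HpSet p k) / k) by exact: level_sum.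
have /andP[fl1 fl2] := real_floor_itv (num_real (- q)).
(* The largest integer strictly below [q]; strictness leaves a positive excess for the kinks. *)
set A := - Num.floor (- q) - 1.
have Aq : A%:~R < q by rewrite /A rmorphB rmorphN /=; move: fl2; rewrite rmorphD /=; lra.
have qA : q <= A%:~R + 1 by rewrite /A rmorphB rmorphN /=; lra.
clearbody A; clear fl1 fl2.
(* Subtracting the remainder [s] from [A] gives the required residue modulo [p - 1]; the quotient
   [u] enters the initial slope. *)
set s := ((A - (z1 + zS)) %% (p%:Z - 1))%Z; set u := ((A - (z1 + zS)) %/ (p%:Z - 1))%Z.
have p2 := prime_gt1 p_pr.
have p1z : 0 < p%:Z - 1 by rewrite subr_gt0 ltz_nat.
have s0 : 0 <= s by rewrite modz_ge0 // gt_eqF.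
have sp : s < p%:Z - 1 by exact: ltz_pmod.
have sE : A - (z1 + zS) = u * (p%:Z - 1) + s by exact: divz_eq.
clearbody s u.
have M_q : q - P < (A - s)%:~R.
  have : s%:~R + 1 <= P - 1 :> R.
    by move: sp; rewrite -lezD1 -(ler_int R) rmorphD rmorphB.
  by rewrite rmorphB /=; lra.
have [N NE] : exists N : nat, A - s = N.+1%:Z.
  have : 0 < A - s by rewrite -(ltr0z R); apply: lt_trans M_q; move: q_large; lra.
  by case: (A - s) => [[|N]|N] // _; exists N.
rewrite NE in M_q.
have lb : forall k, cover_order_le (dlt p) (H0rho p D (P ^+ n)) k -> (N < k)%N.
  apply: (@H0_cover_order_ge R p p_pr D S n N _ _ _ _ _ ((zS - N.+1%:Z - u)%:~R / P ^+ n)) => //.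
  - by eexists.
  - rewrite zSE z1E.
    have z1' : z1%:~R = N.+1%:R - zS%:~R - u%:~R * (P - 1).
      have : z1 = N.+1%:Z - zS - u * (p%:Z - 1).
        rewrite -NE; transitivity (A - (A - (z1 + zS)) - zS); first by ring.
        by rewrite sE; ring.
      by move=> ->; rewrite !rmorphB rmorphM rmorphB.
    by rewrite z1' !rmorphB /=; field; rewrite gt_eqF.
  - by rewrite subr_gt0 -/q; apply: le_lt_trans Aq;
      rewrite -[N.+1%:R]/(N.+1%:Z%:~R) ler_int -NE lerBlDr lerDl.
  - by move: M_q; rewrite -/q -pmulrn; lra.
  - by move: M_q q_large; rewrite -pmulrn; lra.
apply: (le_trans _ (covdim_ge lb)); rewrite lee_fin.
by move: M_q; rewrite -pmulrn -natr1; lra.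
Qed.

(** The errors 1 above and [P + 1] below do not depend on [n], so both bounds squeeze to the same
    limit. *)
Lemma DimSeq_cvg (D : set R -> R) : isDivisor p D ->
  DimSeq p D @ \oo --> (Num.max (deg p D) 0)%:E.
Proof.
move=> Ddiv; set d := Num.max _ _.
have P0 := p_gt0 R p_pr; have P1 := p_gt1 R p_pr.
have [m1 ub] := covdim_H0_le Ddiv.
have [m2 lb] : exists m, forall n, (m <= n)%N ->
    ((P ^+ n * d - (P + 1))%:E <= covdim (dlt p) (H0rho p D (P ^+ n)))%E.
  case: (ltP 0 (deg p D)) => h.
    by have [m Hm] := covdim_H0_ge Ddiv h; exists m => n /Hm; rewrite /d max_l // ltW.
  exists 0%N => n _; apply: le_trans (covdim_ge0 _ _); rewrite lee_fin /d max_r //; lra.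
have Pn : (P ^- n @[n --> \oo] --> (0 : R)).
  have : `|P^-1| < 1 by rewrite gtr0_norm ?invr_gt0 // invf_lt1.
  by move/cvg_expr; apply: cvg_trans; apply: near_eq_cvg; near=> n; rewrite exprVn.
apply: (@squeeze_cvge _ _ _ _ (fun n => (d - P ^- n * (P + 1))%:E) _ (fun n => (d + P ^- n)%:E)).
- near=> n; have Pn0 : 0 < P ^+ n by rewrite exprn_gt0.
  have n1 : (m1 <= n)%N by near: n; exists m1.
  have n2 : (m2 <= n)%N by near: n; exists m2.
  have iP : (0 <= (P ^- n)%:E)%E by rewrite lee_fin invr_ge0 ltW.
  rewrite /DimSeq; apply/andP; split.
    apply: le_trans (lee_wpmul2l iP (lb n n2)); rewrite -EFinM lee_fin mulrBr mulKf ?gt_eqF //.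
  apply: le_trans (lee_wpmul2l iP (ub n n1)) _;
    rewrite -EFinM lee_fin mulrDr mulr1 mulKf ?gt_eqF //.
- apply: cvg_EFin; first by near=> n.
  rewrite -[X in _ --> X]subr0 -[X in _ - X](mul0r (P + 1)).
  by apply: cvgB; [exact: cvg_cst|apply: cvgM Pn _; exact: cvg_cst].
- apply: cvg_EFin; first by near=> n.
  by rewrite -[X in _ --> X]addr0; apply: cvgD Pn; exact: cvg_cst.
Unshelve. all: by end_near. Qed.

Lemma isDivisorN (D : set R -> R) : isDivisor p D -> isDivisor p (fun H => - D H).
Proof.
move=> [D0 DH Dfin]; split.
- by move=> H /D0 ->; rewrite oppr0.
- move=> H CH; have := DH H CH; case: CH => l [l0 ->] [h hH hE].
  by exists (- h); [exact: inHpN|rewrite mulrN hE].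
- by apply: sub_finite_set Dfin => H [CH]; rewrite oppr_eq0.
Qed.

Lemma degN (D : set R -> R) : deg p (fun H => - D H) = - deg p D.
Proof.
rewrite /deg -[RHS]mulN1r mulr_fsumr; have -> : [set H | Cp p H /\ - D H != 0] = [set H | Cp p H
  /\ D H != 0].
  by apply/seteqP; split => H /=; rewrite oppr_eq0.
by apply: eq_fsbigr => H _; rewrite mulN1r.
Qed.

End Dimension.

Theorem theorem5p17 (R : realType) (p : nat) (hp : prime p) :
  (forall D : set R -> R, isDivisor p D -> 0 <= deg p D ->
     DimSeq p D @ \oo --> (deg p D)%:E)
  /\
  (forall D : set R -> R, isDivisor p D ->
     exists a b : R,
       DimSeq p D @ \oo --> a%:E /\
       DimSeq p (fun H => - D H) @ \oo --> b%:E /\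
       a - b = deg p D).
Proof.
split=> [D Ddiv d0|D Ddiv]; first by have := DimSeq_cvg hp Ddiv; rewrite max_l.
exists (Num.max (deg p D) 0), (Num.max (- deg p D) 0); split; first exact: DimSeq_cvg.
split; first by rewrite -degN; exact/DimSeq_cvg/isDivisorN.
have [d0|d0] := leP (deg p D) 0; first by rewrite max_l ?oppr_ge0 // sub0r opprK.
by rewrite max_r ?subr0 // oppr_le0 ltW.
Qed.
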